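(* For every connected graph $G$ which is not isomorphic to $K_2$, ${\rm lir}(^2G)\le 76$.
   Context: For a graph $G$, $^2G$ denotes the multigraph obtained from $G$ by replacing every edge by two parallel edges. The degree of a vertex in a multigraph counts parallel edges with multiplicity. A multigraph is locally irregular if any two adjacent vertices have distinct degrees. A locally irregular edge coloring of a multigraph $M$ is an assignment of colors to the individual edges of $M$ (the two parallel copies of an edge may receive different colors) such that, for each color, the submultigraph formed by the edges of that color is locally irregular. ${\rm lir}(M)$ is the smallest number of colors in a locally irregular edge coloring of $M$. *)

(* Defs.v *)
From mathcomp Require Import all_boot.
Set Implicit Arguments.
Unset Strict Implicit.
Unset Printing Implicit Defensive.

Record sgraph := SGraph {
  svertex :> finType;
  sedge : rel svertex;
  sedge_sym : symmetric sedge;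
  sedge_irrefl : irreflexive sedge
}.

Definition connected_graph (G : sgraph) : Prop :=
  (exists x : G, True) /\ (forall x y : G, connect (@sedge G) x y).

Definition isomorphic (G H : sgraph) : Prop :=
  exists2 f : G -> H, bijective f & forall x y, sedge (f x) (f y) = sedge x y.

Lemma neq_sym (T : eqType) : symmetric (fun x y : T => x != y).
Proof. by move=> x y; rewrite eq_sym. Qed.

Lemma neq_irrefl (T : eqType) : irreflexive (fun x y : T => x != y).
Proof. by move=> x; rewrite eqxx. Qed.

Definition complete_graph (n : nat) : sgraph :=
  @SGraph 'I_n (fun x y => x != y) (@neq_sym _) (@neq_irrefl _).

Definition edge_set (G : sgraph) : {set {set G}} :=
  [set A | [exists x, exists y, sedge x y && (A == [set x; y])]].

Lemma card_edge_set (G : sgraph) (A : {set G}) : A \in edge_set G -> #|A| = 2.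
Proof.
rewrite inE => /existsP[x /existsP[y /andP[xy /eqP->]]]; rewrite cards2.
by case: eqP xy => // ->; rewrite sedge_irrefl.
Qed.

(* Loopless multigraphs: edges are individual objects, so that parallel edges
   are distinct elements of [medge] with the same endpoints. *)
Record multigraph := Multigraph {
  mvertex : finType;
  medge : finType;
  ends : medge -> {set mvertex};
  card_ends : forall x, #|ends x| = 2
}.

Definition mdeg (M : multigraph) (v : mvertex M) : nat :=
  #|[set x : medge M | v \in ends x]|.

Definition madj (M : multigraph) (u v : mvertex M) : bool :=
  [exists x : medge M, ends x == [set u; v]].

Definition locally_irregular (M : multigraph) : Prop :=
  forall u v : mvertex M, madj u v -> mdeg u <> mdeg v.

(* The vertices met by no selected edge are kept; being isolated, they do not
   affect local irregularity. *)
Definition edge_submultigraph (M : multigraph) (P : pred (medge M)) :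
    multigraph :=
  @Multigraph (mvertex M) {x : medge M | P x} (fun x => ends (val x))
    (fun x => card_ends (val x)).

Definition locally_irregular_coloring (M : multigraph) (k : nat)
    (c : medge M -> 'I_k) : Prop :=
  forall i : 'I_k, locally_irregular (edge_submultigraph (fun x => c x == i)).

Definition locally_irregular_colorable (M : multigraph) (k : nat) : Prop :=
  exists c : medge M -> 'I_k, locally_irregular_coloring c.

(* [is_lir M k] means lir(M) = k; it is a relation because some multigraphs
   (such as the doubled K_2) have no locally irregular edge coloring. *)
Definition is_lir (M : multigraph) (k : nat) : Prop :=
  locally_irregular_colorable M k /\
  forall j : nat, locally_irregular_colorable M j -> k <= j.

(* The two parallel copies of an edge [A] are [(A, false)] and [(A, true)]. *)
Definition double_graph (G : sgraph) : multigraph :=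
  @Multigraph G ({A : {set G} | A \in edge_set G} * bool)%type
    (fun x => val x.1) (fun x => card_edge_set (valP x.1)).

(* Main.v *)
Require Import Defs.
From mathcomp Require Import all_boot zify.
From Stdlib Require Import Classical.
Set Implicit Arguments.
Unset Strict Implicit.
Unset Printing Implicit Defensive.

(** A colouring of [2G] is a family of symmetric weights [V -> V -> nat] adding
up to twice the adjacency matrix, each of them with distinct degrees at the two
ends of every edge of positive weight. The only obstruction is an edge of [G]
with no adjacent edge.

A bipartite graph needs three colours: up to a few defects, weights 1 on a
suitable set of edges make the degrees odd on one side and even on the other. A
graph of bounded degree needs boundedly many: split it into stars, each edge
giving one copy to each end.

In general, cut the vertices into three parts so that every vertex has at least
as many neighbours in the next part as in its own. The edges inside a part are
cut further into bipartite graphs until the remaining degrees inside are at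
most a quarter of the degrees towards the next part. The latter edges then give
each vertex the freedom to avoid greedily the degrees of its inner neighbours,
while parity separates it from the next part: some vertices own disjoint sets
of neighbours, which serve both as their own freedom and, by the edge to the
owner, to make odd the degrees of the vertices that all others use. What is left
between consecutive parts is bipartite, and its isolated edges are hung on
neighbouring edges of another colour class. *)

(** * Weights and decompositions *)

Section Weights.
Variable V : finType.
Implicit Types (w m : V -> V -> nat) (r : rel V).

Definition wdeg w v := \sum_u w v u.

Definition irregular w :=
  (forall u v, w u v = w v u) /\
  (forall u v, 0 < w u v -> wdeg w u <> wdeg w v).

Definition decomp (good : (V -> V -> nat) -> Prop) n m :=
  exists w : nat -> V -> V -> nat,
    (forall c, good (w c)) /\
    (forall u v, m u v = \sum_(c < n) w c u v).

Definition deg r v := #|[set u | r v u]|.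

Definition isolated_edge r u v :=
  [&& r u v, [forall x, r u x ==> (x == v)] & [forall x, r v x ==> (x == u)]].

(** The isolated edges are deferred to another colour class: a doubled edge on its own is never
    irregular. *)
Definition core r u v := r u v && ~~ isolated_edge r u v.

Definition no_isolated_edge r :=
  forall u v, r u v -> exists x, r u x && (x != v) \/ r v x && (x != u).

Lemma degE r v : deg r v = \sum_u (r v u : nat).
Proof. by rewrite /deg -sum1dep_card big_mkcond; apply: eq_bigr => u _; case: r. Qed.

Lemma eq_wdeg w1 w2 v : (forall u, w1 v u = w2 v u) -> wdeg w1 v = wdeg w2 v.
Proof. by move=> e; apply: eq_bigr => u _. Qed.

Lemma wdeg_gt0 w u v : 0 < w u v -> 0 < wdeg w u.
Proof. by move=> h; rewrite /wdeg (bigD1 v) //=; lia. Qed.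

Lemma leq_wdeg2 w u v v' : v != v' -> w u v + w u v' <= wdeg w u.
Proof.
by move=> d; rewrite /wdeg (bigD1 v) //= (bigD1 v') ?(eq_sym v') //=; lia.
Qed.

Lemma wdegD w1 w2 v :
  wdeg (fun a b => w1 a b + w2 a b) v = wdeg w1 v + wdeg w2 v.
Proof. exact: big_split. Qed.

Lemma wdeg_mul k w v : wdeg (fun a b => k * w a b) v = k * wdeg w v.
Proof. by rewrite /wdeg big_distrr. Qed.

Lemma irregular0 : irregular (fun _ _ => 0).
Proof. by []. Qed.

Lemma eq_decomp good n m1 m2 :
  (forall u v, m1 u v = m2 u v) -> decomp good n m1 -> decomp good n m2.
Proof. by move=> e [w [h1 h2]]; exists w; split=> // u v; rewrite -e. Qed.

Lemma decomp1 (good : (V -> V -> nat) -> Prop) w : good w -> decomp good 1 w.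
Proof.
by move=> h; exists (fun _ => w); split=> // u v; rewrite big_ord1.
Qed.

Lemma decompD good n1 n2 m1 m2 : decomp good n1 m1 -> decomp good n2 m2 ->
  decomp good (n1 + n2) (fun u v => m1 u v + m2 u v).
Proof.
move=> [w1 [h1 e1]] [w2 [h2 e2]].
exists (fun c => if c < n1 then w1 c else w2 (c - n1)); split=> [c|u v].
  by case: ifP.
rewrite big_split_ord e1 e2; congr (_ + _); apply: eq_bigr => c _ /=.
  by rewrite ltn_ord.
by rewrite ltnNge leq_addr addKn.
Qed.

Lemma decomp_sum (I : Type) (s : seq I) n (m : I -> V -> V -> nat) :
  (forall i, decomp irregular n (m i)) ->
  decomp irregular (size s * n) (fun u v => \sum_(i <- s) m i u v).
Proof.
move=> h; elim: s => [|i s IH].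
  exists (fun _ _ _ => 0); split=> [c|u v]; first exact: irregular0.
  by rewrite big_nil big_ord0.
rewrite mulSn; apply: eq_decomp (decompD (h i) IH) => u v.
by rewrite big_cons.
Qed.

Lemma decomp_leq n1 n2 m : n1 <= n2 ->
  decomp irregular n1 m -> decomp irregular n2 m.
Proof.
move=> le [w [h e]]; exists (fun c => if c < n1 then w c else fun _ _ => 0).
split=> [c|u v]; first by case: ifP => // _; apply: irregular0.
rewrite e (big_ord_widen n2 (fun c => w c u v) le) big_mkcond.
by apply: eq_bigr => c _; case: ifP.
Qed.

Lemma isolated_edge_sym r : symmetric r -> symmetric (isolated_edge r).
Proof. by move=> s u v; rewrite /isolated_edge s; congr (_ && _); rewrite andbC. Qed.

Lemma isolated_edgeP r u v : symmetric r -> isolated_edge r u v ->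
  [/\ r u v, forall x, r u x -> x = v & forall x, r v x -> x = u].
Proof.
move=> s /and3P[h /forallP h1 /forallP h2]; split=> // x hx.
  by have /implyP/(_ hx)/eqP := h1 x.
by have /implyP/(_ hx)/eqP := h2 x.
Qed.

Lemma not_isolated_edge r u v : r u v -> ~~ isolated_edge r u v ->
  exists x, r u x && (x != v) \/ r v x && (x != u).
Proof.
move=> h; rewrite /isolated_edge h /= negb_and !negb_forall.
case/orP=> /existsP[x]; rewrite negb_imply => hx; exists x; [by left|by right].
Qed.

Lemma core_sym r : symmetric r -> symmetric (core r).
Proof. by move=> s u v; rewrite /core isolated_edge_sym // s. Qed.

(** No other edge meets an isolated edge, so the neighbour that keeps an edge from being isolated
    survives in [core r]. *)
Lemma core_no_isolated r : symmetric r -> no_isolated_edge (core r).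
Proof.
move=> s u v /andP[h hi]; have [x hx] := not_isolated_edge h hi.
exists x; case: hx => /andP[hx ne]; [left|right].
  rewrite ne andbT /core hx /=; apply/negP => /(isolated_edgeP s)[_ h2 _].
  by move: ne; rewrite (h2 v h) eqxx.
rewrite ne andbT /core hx /=; apply/negP => /(isolated_edgeP s)[_ h2 _].
by move: ne; rewrite -(h2 u) ?eqxx // s.
Qed.

(** Take [f] with the fewest monochromatic edges: if [v] had fewer neighbours in class [j] than in
    its own, moving [v] to [j] would lower their number. *)
Lemma local_cut (K : finType) (k0 : K) r : symmetric r -> irreflexive r ->
  exists f : V -> K, forall v j,
    deg (fun u x => r u x && (f x == f u)) v
      <= deg (fun u x => r u x && (f x == j)) v.
Proof.
move=> rs ri.
pose mono (f : {ffun V -> K}) := \sum_u \sum_x (r u x && (f x == f u) : nat).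
case: (arg_minnP mono (P := xpredT) (i0 := [ffun=> k0])) => // f _ fmin.
exists f => v j; rewrite !degE leqNgt; apply/negP => lt.
pose f' := [ffun x => if x == v then j else f x].
have := fmin f' isT; apply/negP; rewrite -ltnNge.
(* Edges at [v] count twice, once from each end; the other term does not see the class of [v]. *)
have split_mono (h : {ffun V -> K}) : mono h =
    2 * (\sum_(x | x != v) (r v x && (h x == h v)))
    + \sum_(u | u != v) \sum_(x | x != v) (r u x && (h x == h u)).
  rewrite /mono (bigD1 v) //= (bigD1 v) //= ri add0n mul2n -addnn -addnA.
  congr (_ + _).
  have -> : \sum_(x | x != v) (r v x && (h x == h v) : nat)
     = \sum_(x | x != v) (r x v && (h v == h x) : nat).
    by apply: eq_bigr => x _; rewrite rs eq_sym.
  by rewrite -big_split; apply: eq_bigr => u _ /=; rewrite (bigD1 v).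
rewrite !split_mono.
have -> : \sum_(u | u != v) \sum_(x | x != v) (r u x && (f' x == f' u) : nat)
   = \sum_(u | u != v) \sum_(x | x != v) (r u x && (f x == f u)).
  apply: eq_bigr => u hu; apply: eq_bigr => x hx.
  by rewrite !ffunE (negbTE hu) (negbTE hx).
rewrite ltn_add2r ltn_pmul2l //; move: lt.
rewrite (bigD1 v) //= ri add0n [ltnRHS](bigD1 v) //= ri add0n.
congr (_ < _); apply: eq_bigr => x hx.
by rewrite !ffunE eqxx (negbTE hx).
Qed.

Lemma local_cut_card (K : finType) r (f : V -> K) v :
  (forall j, deg (fun u x => r u x && (f x == f u)) v
      <= deg (fun u x => r u x && (f x == j)) v) ->
  #|K| * deg (fun u x => r u x && (f x == f u)) v <= deg r v.
Proof.
move=> h; rewrite -sum_nat_const.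
apply: (@leq_trans (\sum_(j : K) deg (fun u x => r u x && (f x == j)) v)).
  by apply: leq_sum => j _; apply: h.
rewrite degE; under eq_bigr do rewrite degE.
rewrite exchange_big /=; apply: leq_sum => x _.
rewrite (bigD1 (f x)) //= big1 ?addn0 ?eqxx ?andbT // => j hj.
by rewrite eq_sym (negbTE hj) andbF.
Qed.

(** In a local cut into [d.+1] classes, [d.+1] times the monochromatic degree is at most [d], so
    this degree is zero. *)
Lemma greedy_coloring r d : symmetric r -> irreflexive r ->
  (forall v, deg r v <= d) ->
  exists f : V -> 'I_d.+1, forall u v, r u v -> f u != f v.
Proof.
move=> rs ri rd; have [f fP] := local_cut (@ord0 d) rs ri.
exists f => u v ruv; apply/negP => /eqP fuv.
have := local_cut_card (fP u); rewrite card_ord => h.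
have := leq_trans h (rd u); apply/negP; rewrite -ltnNge.
have : 0 < deg (fun u x => r u x && (f x == f u)) u.
  by apply/card_gt0P; exists v; rewrite inE ruv fuv eqxx.
by move=> gt0; rewrite leq_pmulr.
Qed.

End Weights.

(** * Stars and bipartite graphs *)

Section Stars.
Variable V : finType.
Implicit Types (r : rel V).

Lemma deg_gt1 r v : 1 < deg r v -> forall u, exists2 x, r v x & x != u.
Proof.
move=> h u; have : 0 < #|[set x | r v x] :\ u|.
  by have := cardsD1 u [set x | r v x]; rewrite -/(deg r v); case: (_ \in _); lia.
by case/card_gt0P=> x; rewrite !inE => /andP[ne h']; exists x.
Qed.

Lemma deg_le1 r v x x' : deg r v <= 1 -> r v x -> r v x' -> x = x'.
Proof.
move=> /card_le1P; rewrite /deg => h hx hx'.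
by have := h x; rewrite inE => /(_ hx) /(_ x'); rewrite inE hx' => /esym/eqP.
Qed.

Lemma deg_gt0 r v x : r v x -> 0 < deg r v.
Proof. by move=> h; apply/card_gt0P; exists x; rewrite inE. Qed.

(* Every non-leaf takes one copy of each of its edges, and both copies of
   those leading to leaves; the resulting stars are coloured so that two stars
   of the same colour are disjoint. *)
Lemma star_decomp r d : symmetric r -> irreflexive r -> no_isolated_edge r ->
  (forall v, deg r v <= d) ->
  decomp (@irregular V) (d * d).+1 (fun u v => 2 * r u v).
Proof.
move=> rs ri rn rd.
pose star v x := if r v x && (1 < deg r v) then (if 1 < deg r x then 1 else 2) else 0.
have starE u v : star u v + star v u = 2 * r u v.
  rewrite /star (rs v u); case huv: (r u v) => //=.
  case du: (1 < deg r u); case dv: (1 < deg r v) => //.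
  case: (rn u v huv) => x [] /andP[hx] /eqP[].
    by apply: (deg_le1 (r := r) (v := u)); rewrite // leqNgt du.
  by apply: (deg_le1 (r := r) (v := v)); rewrite // ?(rs v u) // leqNgt dv.
have starr u v : 0 < star u v -> r u v by rewrite /star; case: (r u v).
(* Stars of the same colour are disjoint once their centres are more than two steps apart. At most
   [d + d * (d - 1)] vertices are nearer, whence [(d * d).+1] classes. *)
pose near u v := (u != v) && (r u v || [exists x, r u x && r x v]).
have ns : symmetric near.
  move=> u v; rewrite /near eq_sym rs; congr (_ && (_ || _)).
  by apply/existsP/existsP => -[x hx]; exists x; rewrite rs andbC rs.
have ni : irreflexive near by move=> u; rewrite /near eqxx.
have nd v : deg near v <= d * d.
  rewrite degE; apply: (@leq_trans (\sum_u \sum_x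
     (r v x * ((u == x) + (r x u && (u != v)))))).
    apply: leq_sum => u _; rewrite /near.
    case: eqP => //= /eqP ne; case: (boolP (r v u)) => [h|_] /=.
      by rewrite (bigD1 u) //= h eqxx; lia.
    case: existsP => // -[x /andP[h1 h2]].
    by rewrite (bigD1 x) //= h1 h2 (eq_sym u v) ne; lia.
  rewrite exchange_big /=; apply: (@leq_trans (\sum_x r v x * d)).
    apply: leq_sum => x _; rewrite -big_distrr /=.
    case h: (r v x); rewrite ?mul0n // !mul1n big_split /=.
    rewrite -big_mkcond sum1_card card1.
    apply: leq_trans (rd x); rewrite degE [leqRHS](bigD1 v) //= rs h.
    rewrite leq_add2l [leqRHS]big_mkcond; apply: leq_sum => u _.
    by case: (u != v); rewrite ?andbT ?andbF.
  by rewrite -big_distrl leq_mul2r -degE rd orbT.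
have [psi psiP] := greedy_coloring ns ni nd.
pose w c u v := (psi u == c :> nat) * star u v + (psi v == c :> nat) * star v u.
exists w; split=> [c|u v]; last first.
  rewrite big_split /= -starE -!big_distrl /=.
  have one x : \sum_(i < (d * d).+1) (psi x == i :> nat) = 1.
    rewrite (bigD1 (psi x)) //= eqxx big1 ?addn0 // => i.
    by rewrite eq_sym => /negbTE ne; rewrite -[_ == _]/(psi x == i) ne.
  by rewrite !one !mul1n.
have ws u v : w c u v = w c v u by rewrite /w addnC.
(* In colour [c] the leaf [v] meets only its edge to the centre [u], which has a further edge. *)
have key u v : psi u = c :> nat -> 0 < star u v -> wdeg (w c) v < wdeg (w c) u.
  move=> hu suv; have ruv := starr _ _ suv.
  have diff x : near u x -> (psi x == c :> nat) = false.
    by move=> /psiP ne; apply/negbTE; move: ne; rewrite -val_eqE /= hu eq_sym.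
  have uv : u != v by apply: contraTneq ruv => ->; rewrite ri.
  have pv : (psi v == c :> nat) = false by apply: diff; rewrite /near uv ruv.
  have -> : wdeg (w c) v = star u v.
    rewrite /wdeg (bigD1 u) //= /w pv hu eqxx mul0n mul1n add0n big1 ?addn0 //.
    move=> x xu; rewrite mul0n add0n.
    case: (posnP (star x v)) => [->|/starr rxv]; first by rewrite muln0.
    rewrite diff // /near eq_sym xu; apply/orP; right; apply/existsP; exists v.
    by rewrite ruv rs.
  have du : 1 < deg r u by move: suv; rewrite /star ruv; case: (1 < _).
  have [x rux xv] := deg_gt1 du v.
  apply: leq_trans (leq_wdeg2 (w c) u xv).
  have : 0 < star u x by rewrite /star rux du; case: ifP.
  by rewrite /w hu eqxx pv !mul1n mul0n addn0; lia.
split=> // u v; rewrite {1}/w; case: (psi u =P c :> nat) => [hu|_].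
  case: (posnP (star u v)) => [->|/(key _ _ hu) lt]; last by lia.
  rewrite muln0 add0n; case: (psi v =P c :> nat) => [hv|//].
  by case: (posnP (star v u)) => [->|/(key _ _ hv) lt]; rewrite ?muln0 //; lia.
case: (psi v =P c :> nat) => [hv|//].
by case: (posnP (star v u)) => [->|/(key _ _ hv) lt]; rewrite ?muln0 //; lia.
Qed.

End Stars.

Section Bipartite.
Variable V : finType.
Implicit Types (r : rel V).

Lemma set2_eq (u v a b : V) :
  ([set u; v] == [set a; b]) = (u == a) && (v == b) || (u == b) && (v == a).
Proof.
apply/eqP/orP => [/setP h|[]/andP[/eqP-> /eqP->]] //; last by rewrite setUC.
have := h u; have := h v; have := h a; have := h b; rewrite !inE !eqxx ?orbT.
rewrite (eq_sym a) (eq_sym b) (eq_sym a v) (eq_sym b v).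
by case: (u == a); case: (v == b); case: (u == b); case: (v == a); auto.
Qed.

Lemma odd_deg r v : odd (deg r v) = \big[addb/false]_u r v u.
Proof.
rewrite degE; elim/big_rec2: _ => // u b n _ <-.
by rewrite oddD; case: (r v u).
Qed.

Section Defects.
Variables (y : rel V) (s : pred V).
Hypotheses (ysym : symmetric y) (ys : forall u v, y u v -> s u != s v).

Definition subrel_of (J : {set {set V}}) u v := y u v && ([set u; v] \in J).

(** [s] is the target parity: odd degrees on the side [s], even ones on the other. *)
Definition defect J v := odd (deg (subrel_of J) v) != s v.

Definition toggle (J : {set {set V}}) A := [set E | (E \in J) (+) (E == A)].

Lemma defect_toggle J a b v : y a b ->
  defect (toggle J [set a; b]) v = defect J v (+) ((v == a) || (v == b)).
Proof.
move=> yab; have ab : a != b by apply/eqP => e; have := ys yab; rewrite e eqxx.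
suff -> : defect (toggle J [set a; b]) v =
    (odd (deg (subrel_of J) v) (+) ((v == a) || (v == b)) != s v).
  by rewrite /defect; case: (odd _); case: (_ || _); case: (s v).
congr (_ != _); rewrite !odd_deg.
transitivity (\big[addb/false]_u (subrel_of J v u (+)
    ((v == a) && (u == b) || (v == b) && (u == a)))).
  apply: eq_bigr => u _; rewrite /subrel_of inE set2_eq.
  case h: (y v u) => //=; apply/esym/negbTE/negP.
  by case/orP=> /andP[/eqP e1 /eqP e2]; move: h; rewrite e1 e2 ?(ysym b) yab.
rewrite big_split; congr (_ (+) _).
case: eqP => [->|_] /=.
  rewrite (negbTE ab) /= (bigD1 b) //= eqxx big1 // => u /negbTE ->.
  by [].
case: eqP => [_|_] /=; last by rewrite big1.
by rewrite (bigD1 a) //= eqxx big1 // => u /negbTE ->.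
Qed.

(* Minimise the number of defects, then the size of J: walking a defect along
   an edge of J, or joining two defects, would decrease one of them. *)
Lemma few_defects : exists J,
  (forall u v, defect J u -> ~~ subrel_of J u v) /\
  (forall u v x, defect J u -> defect J v -> y x u -> y x v -> u = v).
Proof.
(* [M] exceeds every [#|J|], so [mu] compares the numbers of defects first. *)
pose M := #|{set V}|.+1.
pose mu J := #|[set v | defect J v]| * M + #|J|.
have [J _ Jmin] := arg_minnP mu (i0 := set0) (P := xpredT) isT.
exists J; split.
  move=> u v du; apply/negP => /andP[yuv uvJ].
  have := Jmin (toggle J [set u; v]) isT; apply/negP; rewrite -ltnNge /mu.
  have -> : toggle J [set u; v] = J :\ [set u; v].
    apply/setP => E; rewrite !inE; case: eqP => [->|_]; first by rewrite uvJ.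
    by rewrite addbF.
  have := cardsD1 [set u; v] J; rewrite uvJ => cJ.
  suff le : #|[set x | defect (J :\ [set u; v]) x]| <= #|[set x | defect J x]|.
    by rewrite cJ add1n addnS ltnS leq_add2r leq_mul2r le orbT.
  have -> : J :\ [set u; v] = toggle J [set u; v].
    apply/setP => E; rewrite !inE; case: eqP => [->|_]; first by rewrite uvJ.
    by rewrite addbF.
  apply: (@leq_trans #|v |: ([set x | defect J x] :\ u)|).
    apply/subset_leq_card/subsetP => x; rewrite !inE defect_toggle //.
    case: (x =P u) => [->|_] /=; first by rewrite du.
    by case: eqP => // _; rewrite addbF.
  rewrite cardsU1; have := cardsD1 u [set x | defect J x]; rewrite inE du.
  by case: (_ \notin _); lia.
move=> u v x du dv xu xv; apply/eqP/negPn/negP => ne.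
(* Toggling the path [u], [x], [v] repairs both ends and changes the parity at [x] twice. *)
pose J' := toggle (toggle J [set x; u]) [set x; v].
have := Jmin J' isT; apply/negP; rewrite -ltnNge /mu.
have x_u : x != u by apply/eqP => e; have := ys xu; rewrite e eqxx.
have x_v : x != v by apply/eqP => e; have := ys xv; rewrite e eqxx.
have -> : [set z | defect J' z] = [set z | defect J z] :\ u :\ v.
  apply/setP => z; rewrite !inE !defect_toggle //.
  case: (z =P u) => [->|_]; first by rewrite du (eq_sym u x) (negbTE x_u) (negbTE ne).
  case: (z =P v) => [->|_]; first by rewrite dv (eq_sym v x) (negbTE x_v).
  by case: (z =P x) => [->|]; case: (defect J _).
have := cardsD1 u [set z | defect J z]; rewrite inE du => c1.
have := cardsD1 v ([set z | defect J z] :\ u); rewrite !inE dv eq_sym ne => c2.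
have : #|J'| < M by rewrite ltnS max_card.
rewrite c1 c2 /=; nia.
Qed.

End Defects.

(** The edges of [J] have weight 1 in two colours, so that parity separates the sides except at
    defects. Defects of degree at least two are centres of disjoint double stars [g], the third
    colour; at a defect of degree one, the single double edge is heavier at its other end. *)
Lemma bipartite_decomp (y : rel V) (s : pred V) : symmetric y ->
  (forall u v, y u v -> s u != s v) -> no_isolated_edge y ->
  decomp (@irregular V) 3 (fun u v => 2 * y u v).
Proof.
move=> ysym ys yn; have [J [noJ far]] := few_defects ysym ys.
pose j := subrel_of y J; pose bad v := defect y s J v.
have jsym : symmetric j by move=> u v; rewrite /j /subrel_of ysym setUC.
have jy u v : j u v -> y u v by case/andP.
have noJl u v : bad u -> j u v = false by move=> /noJ h; apply/negbTE.
have noJr u v : bad v -> j u v = false by rewrite jsym; apply: noJl.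
(* A defect has degree 0 in [J], which is correct on the even side. *)
have bad_s v : bad v -> s v.
  move=> bv; move: (bv); rewrite /bad /defect; case: (s v) => //; rewrite eqbF_neg negbK.
  have -> : deg (subrel_of y J) v = 0; last by [].
  by apply: eq_card0 => u; rewrite inE; apply: noJl.
pose g u v := y u v && (bad u && (1 < deg y u) || bad v && (1 < deg y v)).
have gsym : symmetric g by move=> u v; rewrite /g ysym orbC.
have gj u v : g u v -> j u v = false.
  by case/andP=> _ /orP[]/andP[b _]; [rewrite noJl|rewrite noJr].
have jparity v : ~~ bad v -> odd (wdeg (fun a b => j a b : nat) v) = s v.
  by move=> /negPn/eqP; rewrite degE.
pose red u v := if y u v && ~~ g u v then (if j u v then 1 else 2) else 0.
have redsym u v : red u v = red v u by rewrite /red ysym gsym jsym.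
(* Outside [g] the weights [red] and [j] add up to 2 on every edge, so their degrees have the same
   parity. *)
have redj v : odd (wdeg red v) = odd (wdeg (fun a b => j a b : nat) v).
  have : wdeg red v + wdeg (fun a b => j a b : nat) v
      = 2 * wdeg (fun a b => y a b && ~~ g a b : nat) v.
    rewrite -wdegD -wdeg_mul; apply: eq_wdeg => u; rewrite /red.
    case hg: (g v u); first by rewrite andbF gj.
    by case hy: (y v u) => //=; case hj: (j v u) => //; rewrite (jy _ _ hj) in hy.
  by lia.
apply: eq_decomp (decompD (decompD (decomp1 (w := red) _)
   (decomp1 (w := fun u v => j u v : nat) _))
   (decomp1 (w := fun u v => 2 * g u v) _)) => [u v|||].
- rewrite /red; case hg: (g u v); first by rewrite andbF gj //; case/andP: hg => ->.
  rewrite muln0 addn0 andbT.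
  by case hy: (y u v) => //=; case hj: (j u v) => //; rewrite (jy _ _ hj) in hy.
- split=> // u0 v0; have key u v : s u -> 0 < red u v -> wdeg red u <> wdeg red v.
    move=> su; rewrite {1}/red; case: ifP => // /andP[yuv ng] _.
    have := ys _ _ yuv; rewrite su; case sv: (s v) => // _.
    have bv : ~~ bad v by apply: contraFN sv; apply: bad_s.
    have pv : odd (wdeg red v) = false by rewrite redj jparity.
    case: (boolP (bad u)) => [bu|bu]; last first.
      by move=> e; move: pv; rewrite -e redj jparity // su.
    have du : deg y u <= 1.
      by rewrite leqNgt; apply: contra ng => h; rewrite /g yuv bu h.
    have ruv : red u v = 2 by rewrite /red yuv ng noJl.
    have -> : wdeg red u = 2.
      rewrite /wdeg (bigD1 v) //= ruv big1 // => x xv; rewrite /red.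
      case yux: (y u x) => //; case/eqP: xv; exact: (deg_le1 du).
    have [x [] /andP[hx /eqP ne]] := yn u v yuv; first by case: ne; apply: (deg_le1 du).
    have ux : u != x by rewrite eq_sym; apply/eqP.
    (* [u] is the only defect next to [v], so the further edge from [v] to [x] is not in [g] and
       makes [v] heavier than [u]. *)
    have ngx : ~~ g v x.
      rewrite /g hx (negbTE bv) /=; apply/negP => /andP[bx _]; case: ne.
      by apply: (far _ _ v) => //; rewrite ysym.
    have : 0 < red v x by rewrite /red hx ngx; case: ifP.
    by have := leq_wdeg2 red v ux; rewrite (redsym v u) ruv; lia.
  case su: (s u0); first exact: key.
  move=> h /esym; apply: key; last by rewrite redsym.
  by move: h; rewrite /red; case: ifP => // /andP[/ys]; rewrite su; case: (s v0).
- split=> [u v|u v]; first by rewrite jsym.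
  case huv: (j u v) => // _.
  have bu : ~~ bad u by apply: contraTN huv => /noJl->.
  have bv : ~~ bad v by apply: contraTN huv => /noJr->.
  move=> e; have := ys _ _ (jy _ _ huv).
  by rewrite -(jparity _ bu) -(jparity _ bv) e eqxx.
split=> [u v|u0 v0]; first by rewrite gsym.
have key u v : y u v -> bad u -> 1 < deg y u ->
    wdeg (fun a b => 2 * g a b) v < wdeg (fun a b => 2 * g a b) u.
  move=> yuv bu du; rewrite !wdeg_mul.
  have -> : wdeg (fun a b => g a b : nat) u = deg y u.
    by rewrite degE; apply: eq_bigr => x _; rewrite /g bu du /= andbT.
  suff : wdeg (fun a b => g a b : nat) v <= 1 by lia.
  have bv : ~~ bad v.
    by apply/negP => /bad_s sv; have := ys _ _ yuv; rewrite sv (bad_s u bu).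
  rewrite /wdeg (bigD1 u) //= big1; first by case: (g v u).
  move=> x xu; rewrite /g (negbTE bv) /=; apply/eqP; rewrite eqb0.
  apply/negP => /and3P[yvx bx _]; case/eqP: xu; apply: (far _ _ v) => //.
  by rewrite ysym.
rewrite muln_gt0 /= lt0b => /andP[yuv /orP[]/andP[b d]].
  by have := key _ _ yuv b d; lia.
by rewrite ysym in yuv; have := key _ _ yuv b d; lia.
Qed.

End Bipartite.

(** * Avoiding degrees greedily *)

Section Palettes.
Variable V : finType.
Implicit Types (r : rel V).

Lemma subset_of_card (A : {set V}) k : k <= #|A| ->
  exists2 B : {set V}, B \subset A & #|B| = k.
Proof.
move=> le; exists [set x in take k (enum A)].
  by apply/subsetP => x; rewrite inE => /mem_take; rewrite mem_enum.
rewrite cardsE; have /card_uniqP -> : uniq (take k (enum A)).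
  by rewrite take_uniq ?enum_uniq.
by rewrite size_take -cardE; case: ltngtP le => // ->.
Qed.

(** The vertices of [Q] are treated one by one: [a] has [n a + 1] choices for [y a] and at most
    [n a] neighbours whose values must be avoided. *)
Lemma greedy_dodge r (Q : {set V}) (base n : V -> nat) : symmetric r ->
  irreflexive r -> (forall a, a \in Q -> deg r a <= n a) ->
  exists y : V -> nat,
    [/\ forall v, y v <= n v, forall v, v \notin Q -> y v = 0 &
        forall a x, a \in Q -> r a x -> base a + y a <> base x + y x].
Proof.
move=> rs ri; move: {2}#|Q| (erefl #|Q|) => q; elim: q Q => [|q IH] Q cQ rn.
  exists (fun _ => 0); split=> // a x aQ.
  by move/eqP: cQ; rewrite cards_eq0 => /eqP Q0; rewrite Q0 inE in aQ.
have [a aQ] : exists a, a \in Q by apply/card_gt0P; rewrite cQ.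
have [||y [yn y0 yP]] := IH (Q :\ a).
- by have := cardsD1 a Q; rewrite aQ cQ; lia.
- by move=> b; rewrite !inE => /andP[_]; apply: rn.
pose used := [seq base x + y x | x <- enum [set x | r a x]].
have [t tn tP] : exists2 t, t <= n a & base a + t \notin used.
  have [/allP all_used|/allPn[t]] := boolP (all (fun t => base a + t \in used) (iota 0 (n a).+1)).
    have /uniq_leq_size : uniq [seq base a + t | t <- iota 0 (n a).+1].
      by rewrite map_inj_uniq ?iota_uniq // => i j /addnI.
    move=> /(_ used); rewrite !size_map size_iota -cardE.
    have := rn a aQ; rewrite /deg => h /(_ _) h'; exfalso.
    suff /h' : {subset [seq base a + t | t <- iota 0 (n a).+1] <= used} by lia.
    by move=> z /mapP[t /all_used h2 ->].
  by rewrite mem_iota => /andP[_ lt] h; exists t => //; rewrite -ltnS.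
exists (fun v => if v == a then t else y v); split=> [v|v|b x bQ rbx].
- by case: eqP => [->|].
- move=> vQ; case: eqP => [e|/eqP ne]; first by rewrite e aQ in vQ.
  by apply: y0; rewrite !inE ne.
case: (b =P a) rbx => [->|/eqP ba] rbx.
  case: (x =P a) rbx => [->|_ rax]; first by rewrite ri.
  by move=> e; case/negP: tP; rewrite e; apply: map_f; rewrite mem_enum inE.
case: (x =P a) rbx => [->|_] rbx; last by apply: yP; rewrite // !inE ba.
by move=> e; case/negP: tP; rewrite -e; apply: map_f; rewrite mem_enum inE rs.
Qed.

(** [P a] is the set owned by [a]. Go through [H]: a vertex with fewer than [2 * n a] owned
    candidates has at least [2 * n a] free ones and takes them; otherwise it stays out of [A], and
    later growth of the owned set does no harm. *)
Lemma private_stars (H : {set V}) (N : V -> {set V}) (n : V -> nat) :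
  (forall a, a \in H -> 4 * n a <= #|N a|) ->
  exists (A : {set V}) (P : V -> {set V}),
    [/\ A \subset H,
        forall a, a \in A -> P a \subset N a /\ #|P a| = 2 * n a,
        forall a, a \notin A -> P a = set0,
        forall a a' b, b \in P a -> b \in P a' -> a = a' &
        forall a, a \in H -> a \notin A ->
          2 * n a <= #|[set b in N a | [exists c, b \in P c]]|].
Proof.
move: {2}#|H| (erefl #|H|) => q; elim: q H => [|q IH] H cH Hn.
  have H0 : H = set0 by apply/eqP; rewrite -cards_eq0 cH.
  exists set0, (fun _ => set0).
  by split=> [|a|a|a a' b|a]; rewrite ?H0 ?sub0set ?inE.
have [a aH] : exists a, a \in H by apply/card_gt0P; rewrite cH.
have [||A [P [AH PN P0 Pd PH]]] := IH (H :\ a).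
- by have := cardsD1 a H; rewrite aH cH; lia.
- by move=> b; rewrite !inE => /andP[_]; apply: Hn.
have aA : a \notin A by apply/negP => /(subsetP AH); rewrite !inE eqxx.
pose B := [set b in N a | [exists c, b \in P c]].
have [le|lt] := leqP (2 * n a) #|B|.
  exists A, P; split=> //.
    by apply: subset_trans AH (subsetDl _ _).
  move=> b bH bA; have [->|ne] := eqVneq b a; first exact: le.
  by apply: PH; rewrite // !inE ne.
have [S SN cS] : exists2 S : {set V}, S \subset N a :\: B & #|S| = 2 * n a.
  apply: subset_of_card; have := Hn a aH; have := cardsID B (N a).
  have : #|N a :&: B| <= #|B| by apply: subset_leq_card (subsetIr _ _).
  by lia.
pose P' c := if c == a then S else P c.
have SP b c : b \in S -> b \in P c -> False.
  move/(subsetP SN); rewrite !inE => /andP[h bN] bP; case/negP: h.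
  by rewrite bN; apply/existsP; exists c.
exists (a |: A), P'; split.
- by rewrite subUset sub1set aH (subset_trans AH (subsetDl _ _)).
- move=> c; rewrite !inE /P'; case: eqP => [-> _|_ /= cA]; last exact: PN.
  by split=> //; apply: subset_trans SN (subsetDl _ _).
- by move=> c; rewrite !inE negb_or /P' => /andP[/negbTE -> cA]; apply: P0.
- move=> c c' b; rewrite /P'; case: eqP => [->|_]; case: eqP => [->|_] // h1 h2.
  + by case: (SP _ _ h1 h2).
  + by case: (SP _ _ h2 h1).
  exact: Pd h1 h2.
move=> c Hc; rewrite !inE negb_or => /andP[ca cA].
apply: leq_trans (PH c _ cA) _; first by rewrite !inE ca.
apply/subset_leq_card/subsetP => b; rewrite !inE => /andP[-> /existsP[d bd]] /=.
apply/existsP; exists d; rewrite /P'; case: eqP => // e.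
by rewrite e P0 ?inE in bd.
Qed.

(* Opposite parities keep a weight irregular when pendant double edges are
   attached to vertices outside of [A]. *)
Definition robust (A : pred V) w := irregular w /\
  (forall b x, ~~ A b -> 0 < w b x -> odd (wdeg w b) != odd (wdeg w x)).

Lemma robustI (A : pred V) w : (forall u v, w u v = w v u) ->
  (forall u v, A u -> A v -> 0 < w u v -> wdeg w u <> wdeg w v) ->
  (forall b x, ~~ A b -> 0 < w b x -> odd (wdeg w b) != odd (wdeg w x)) ->
  robust A w.
Proof.
move=> s h1 h2; split=> //; split=> // u v wuv e.
case Au: (A u); last by have := h2 u v; rewrite Au e eqxx => /(_ isT wuv).
case Av: (A v); last by have := h2 v u; rewrite Av e eqxx s => /(_ isT wuv).
exact: h1 Au Av wuv e.
Qed.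

(** Both copies of a pendant edge from [h] to [x] take one colour already present at [h]. There [x]
    has degree 2, less than [h], and the even increment keeps the parity of [h] apart from that of
    its other neighbours. *)
Lemma attach_pendants (A : pred V) n m (t : rel V) : decomp (robust A) n m ->
  (forall h x, t h x ->
    [/\ ~~ A h, exists u, 0 < m h u & forall u, m x u = 0]) ->
  (forall h x x', t h x -> t h x' -> x = x') ->
  (forall h h' x, t h x -> t h' x -> h = h') ->
  decomp (@irregular V) n (fun u v => m u v + 2 * (t u v + t v u)).
Proof.
move=> [w [wr wm]] th tx hx.
pose pos h (c : 'I_n) := 0 < wdeg (w c) h.
pose gam h : option 'I_n := [pick c | pos h c].
pose tc (c : nat) u v := t u v && (if gam u is Some d then d == c :> nat else false).
have mw u v c : c < n -> 0 < w c u v -> 0 < m u v.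
  by move=> lt; rewrite wm (bigD1 (Ordinal lt)) //=; lia.
have gamP h x : t h x -> exists2 c, gam h = Some c & 0 < wdeg (w c) h.
  move=> /th[_ [u mu] _]; rewrite /gam; case: pickP => [c hc|none]; first by exists c.
  move: mu; rewrite wm lt0n sum_nat_eq0 => /forallPn[c]; rewrite -lt0n => wc.
  by have := none c; rewrite /pos (wdeg_gt0 wc).
exists (fun c => if c < n then (fun u v => w c u v + 2 * (tc c u v + tc c v u)) else w c).
split=> [c|u v]; last first.
  under eq_bigr do rewrite ltn_ord.
  rewrite big_split wm -big_distrr big_split /=; congr (_ + 2 * (_ + _)).
    case h: (t u v); last by rewrite big1 // => c _; rewrite /tc h.
    have [c gc _] := gamP _ _ h.
    rewrite (bigD1 c) //= /tc h gc eqxx big1 // => d dc.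
    by rewrite -[_ == _]/(c == d) eq_sym (negbTE dc).
  case h: (t v u); last by rewrite big1 // => c _; rewrite /tc h.
  have [c gc _] := gamP _ _ h.
  rewrite (bigD1 c) //= /tc h gc eqxx big1 // => d dc.
  by rewrite -[_ == _]/(c == d) eq_sym (negbTE dc).
case: ifP => [cn|_]; last by case: (wr c).
have [[ws wi] wp] := wr c.
pose k v := wdeg (fun u v => tc c u v + tc c v u) v.
have degw' v : wdeg (fun u v => w c u v + 2 * (tc c u v + tc c v u)) v
    = wdeg (w c) v + 2 * k v by rewrite wdegD wdeg_mul.
have w0 u x : (forall u, m x u = 0) -> w c x u = 0.
  move=> mx; apply/eqP; rewrite -leqn0 leqNgt; apply/negP => /(mw _ _ _ cn).
  by rewrite mx.
have kA u v : A u -> 0 < w c u v -> k u = 0.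
  move=> Au wuv; apply/eqP; rewrite /k /wdeg sum_nat_eq0; apply/forallP => x /=.
  rewrite addn_eq0 !eqb0 /tc; apply/andP; split; apply/negP => /andP[h _].
    by have [] := th _ _ h; rewrite Au.
  by have [_ _ /(w0 v)] := th _ _ h; rewrite -(prednK wuv).
have pend h x : tc c h x -> k x = 1 /\ wdeg (w c) x = 0 /\ 0 < wdeg (w c) h /\ 0 < k h.
  move=> hhx; have /andP[hx0 ghx] := hhx; have [_ _ mx] := th _ _ hx0.
  have notx z : t x z = false.
    by apply/negP => /th[_ [u mu] _]; rewrite mx in mu.
  split; last split; last split.
  - rewrite /k /wdeg (bigD1 h) //= hhx big1 => [|z zh].
      by rewrite /tc notx.
    rewrite /tc notx /=; case hz: (t z x) => //.
    by move: zh; rewrite (hx _ _ _ hz hx0) eqxx.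
  - by rewrite /wdeg big1 // => z _; apply: w0.
  - have [d gd] := gamP _ _ hx0; move: ghx; rewrite gd => /eqP <- //.
  by rewrite /k /wdeg (bigD1 x) //= hhx.
split=> [u v|u v]; first by rewrite ws (addnC (tc c u v : nat)).
rewrite !degw'; case: (posnP (w c u v)) => [->|wuv _].
  rewrite add0n muln_gt0 /= addn_gt0 !lt0b => /orP[]/pend.
    by move=> [-> [-> [? ?]]]; lia.
  by move=> [-> [-> [? ?]]]; lia.
have wvu : 0 < w c v u by rewrite ws.
case Au: (A u); last first.
  have := wp u v; rewrite Au => /(_ isT wuv) ne e; case/eqP: ne; lia.
case Av: (A v); last first.
  have := wp v u; rewrite Av => /(_ isT wvu) ne e; case/eqP: ne; lia.
by rewrite (kA _ _ Au wuv) (kA _ _ Av wvu); have := wi _ _ wuv; lia.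
Qed.

End Palettes.

(** * Colouring the edges inside one part *)

Section Palette.
Variables (V : finType) (A : pred V) (X : rel V).
Hypothesis XA : forall a b, X a b -> A a && ~~ A b.

Lemma X_left a b : A b -> X a b = false.
Proof. by move=> Ab; apply/negP => /XA; rewrite Ab andbF. Qed.

Lemma X_right a b : ~~ A a -> X a b = false.
Proof. by move=> Aa; apply/negP => /XA; rewrite (negbTE Aa). Qed.

(* [I] is the part of a weight inside [A] and [D] its part on the edges of [X],
   oriented away from [A]. *)
Lemma wdeg_sided (I D : V -> V -> nat) v : (forall u v, 0 < I u v -> A u && A v) ->
  (forall u v, 0 < D u v -> X u v) ->
  wdeg (fun u v => I u v + (D u v + D v u)) v =
  if A v then wdeg I v + wdeg D v else \sum_u D u v.
Proof.
move=> IA DX; rewrite !wdegD; case: ifP => Av.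
  have -> : wdeg (fun u v => D v u) v = 0; last by lia.
  rewrite /wdeg big1 // => u _; apply/eqP; rewrite -leqn0 leqNgt.
  by apply/negP => /DX; rewrite X_left.
have -> : wdeg I v = 0.
  rewrite /wdeg big1 // => u _; apply/eqP; rewrite -leqn0 leqNgt.
  by apply/negP => /IA; rewrite Av.
have -> // : wdeg D v = 0.
rewrite /wdeg big1 // => u _; apply/eqP; rewrite -leqn0 leqNgt.
by apply/negP => /DX; rewrite X_right ?Av.
Qed.

(** The parities [p] and [~~ p] separate the ends of the edges of [D]; the edges of [I] have both
    ends in [A], where the degree is the sum of the two. *)
Lemma robust_sided p (I D : V -> V -> nat) :
  (forall u v, I u v = I v u) ->
  (forall u v, 0 < I u v -> A u && A v) ->
  (forall u v, 0 < D u v -> X u v) ->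
  (forall a b, 0 < D a b -> odd (wdeg I a + wdeg D a) = p) ->
  (forall a b, 0 < D a b -> odd (\sum_u D u b) = ~~ p) ->
  (forall u v, 0 < I u v -> wdeg I u + wdeg D u <> wdeg I v + wdeg D v) ->
  robust A (fun u v => I u v + (D u v + D v u)).
Proof.
move=> Is IA DX pA pB ID; have dE := wdeg_sided _ IA DX.
apply: robustI => [u v|u v Au Av|b x Ab].
- by rewrite Is (addnC (D u v)).
- rewrite !dE Au Av; case: (posnP (D u v)) => [->|/DX]; last by rewrite X_left.
  case: (posnP (D v u)) => [->|/DX]; last by rewrite X_left.
  by rewrite !addn0; apply: ID.
case: (posnP (I b x)) => [->|/IA]; last by rewrite (negbTE Ab).
case: (posnP (D b x)) => [->|/DX]; last by rewrite X_right.
rewrite !add0n => Dxb; rewrite !dE (negbTE Ab).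
have /andP[-> _] := XA (DX _ _ Dxb).
by rewrite (pA _ _ Dxb) (pB _ _ Dxb); case: p {pA pB}.
Qed.

Variables (O : rel V) (hi : pred V).
Hypotheses (Os : symmetric O) (Oi : irreflexive O).
Hypothesis OA : forall u v, O u v -> A u && A v.
Hypothesis Ohi : forall u v, O u v -> hi u || hi v.
Hypothesis hiO : forall v, hi v -> deg O v <= deg X v %/ 4.

Lemma sum_in (S : V -> {set V}) v : \sum_u (u \in S v : nat) = #|S v|.
Proof. by rewrite -sum1_card [RHS]big_mkcond; apply: eq_bigr => u _; case: ifP. Qed.

Lemma sum_private (P : V -> {set V}) a b :
  (forall a a' b, b \in P a -> b \in P a' -> a = a') -> b \in P a ->
  \sum_u (b \in P u : nat) = 1.
Proof.
move=> Pd bP; rewrite (bigD1 a) //= bP big1 // => u ua.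
by case: (boolP (b \in P u)) => // bu; rewrite (Pd _ _ _ bP bu) eqxx in ua.
Qed.

(* The vertices of a set A1 own disjoint sets P a of neighbours; every other
   high vertex has many neighbours among the owned vertices, whose degree in
   [red2] is made odd by the edge to their owner. *)
Lemma palette_high : exists U : rel V,
  [/\ forall a b, U a b -> X a b && hi a,
      forall a, hi a -> deg U a <= deg X a %/ 2 &
      decomp (robust A) 3 (fun u v => 2 * O u v + 2 * (U u v + U v u))].
Proof.
pose n v := deg X v %/ 4; pose N v := [set b | X v b].
have n4 a : 4 * n a <= #|N a| by rewrite /n -/(deg X a); lia.
have [A1 [P [A1hi PN P0 Pd PH]]] := private_stars (H := [set v | hi v]) (fun a _ => n4 a).
pose A2 := [set v | hi v] :\: A1.
pose O2 u v := O u v && ((u \in A2) || (v \in A2)).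
pose O1 u v := O u v && ~~ ((u \in A2) || (v \in A2)).
have O2s : symmetric O2 by move=> u v; rewrite /O2 Os orbC.
have O1s : symmetric O1 by move=> u v; rewrite /O1 Os orbC.
have O2i : irreflexive O2 by move=> u; rewrite /O2 Oi.
have O1i : irreflexive O1 by move=> u; rewrite /O1 Oi.
have O2O v : deg O2 v <= deg O v.
  by apply/subset_leq_card/subsetP => u; rewrite !inE => /andP[].
have O1O v : deg O1 v <= deg O v.
  by apply/subset_leq_card/subsetP => u; rewrite !inE => /andP[].
have A2hi v : v \in A2 -> hi v by rewrite !inE => /andP[].
have hiA1 v : v \in A1 -> hi v by move/(subsetP A1hi); rewrite inE.
have nA12 v : v \in A1 -> v \in A2 -> False by rewrite inE => ->.
have PA1 a b : b \in P a -> a \in A1.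
  by apply: contraTT => /P0 ->; rewrite inE.
have PX a b : b \in P a -> X a b.
  by move=> h; have [/subsetP/(_ _ h)] := PN a (PA1 _ _ h); rewrite inE.
(* In the colours of [O2] and [O1] the degrees inside the part are even, so halves are compared.
   With [O2], a vertex of [A1] also has [2 * n v] single private edges, worth [n v]. *)
pose base2 v := deg O2 v + (if v \in A1 then n v else 0).
have [||v vA2|y2 [y2n y20 y2P]] := greedy_dodge (r := O2) (Q := A2) base2 (n := n) => //.
  by apply: leq_trans (O2O v) (hiO (A2hi _ vA2)).
have [||v vA1|y1 [y1n y10 y1P]] := greedy_dodge (r := O1) (Q := A1) (deg O1) (n := n) => //.
  by apply: leq_trans (O1O v) (hiO (hiA1 _ vA1)).
(* [C a] realises [y2 a] by doubled edges to owned neighbours; [S a], below, realises [y1 a] by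
   [2 * y1 a] single edges to private ones. *)
have /fin_all_exists[C CP] : forall a, exists C : {set V},
    [/\ C \subset [set b in N a | [exists c, b \in P c]], #|C| = y2 a
      & a \notin A2 -> C = set0].
  move=> a; case: (boolP (a \in A2)) => aA2; last first.
    by exists set0; rewrite sub0set cards0 y20.
  have [|C CN cC] := subset_of_card (A := [set b in N a | [exists c, b \in P c]]) (k := y2 a).
    by move: (aA2); rewrite !inE => /andP[aA1 ah]; have := PH a; rewrite inE => /(_ ah aA1);
       have := y2n a; lia.
  by exists C.
have /fin_all_exists[S SP] : forall a, exists S : {set V}, S \subset P a /\ #|S| = 2 * y1 a.
  move=> a; case: (boolP (a \in A1)) => aA1; last first.
    by exists set0; rewrite sub0set cards0 y10.
  have [|S SN cS] := subset_of_card (A := P a) (k := 2 * y1 a).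
    by have [_ ->] := PN a aA1; rewrite leq_mul2l y1n orbT.
  by exists S.
have CX a b : b \in C a -> X a b.
  by move=> h; have [/subsetP/(_ _ h)] := CP a; rewrite !inE => /andP[].
have CA2 a b : b \in C a -> a \in A2.
  by apply: contraTT => h; have [_ _ /(_ h) ->] := CP a; rewrite inE.
have CB a b : b \in C a -> exists c, b \in P c.
  by move=> h; have [/subsetP/(_ _ h)] := CP a; rewrite !inE => /andP[_ /existsP].
have SPa a b : b \in S a -> b \in P a.
  by move=> h; have [/subsetP/(_ _ h)] := SP a.
have Sd a a' b : b \in S a -> b \in S a' -> a = a'.
  by move=> /SPa h /SPa; apply: Pd.
have disj a b : b \in C a -> b \in P a -> False.
  by move=> /CA2 h /PA1 h'; apply: nA12 h' h.
have cP a : #|P a| = 2 * (if a \in A1 then n a else 0).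
  by case: ifP => [/PN[]|/negbT/P0 ->] //; rewrite cards0.
pose U a b := (b \in C a) || (b \in P a).
exists U; split.
- move=> a b /orP[h|h]; first by rewrite (CX _ _ h) A2hi ?(CA2 _ _ h).
  by rewrite (PX _ _ h) hiA1 ?(PA1 _ _ h).
- move=> a ha; have le : deg U a <= #|C a| + #|P a|.
    rewrite -cardsUI; apply: leq_trans (leq_addr _ _).
    by apply/subset_leq_card/subsetP => b; rewrite !inE.
  have [_ cC C0] := CP a; rewrite cP in le.
  case: (boolP (a \in A1)) le => aA1; rewrite cC.
    by rewrite y20 ?inE ?aA1 // /n; lia.
  by have := y2n a; rewrite /n; lia.
(* First [O2] with both copies of the edges to [C] and one of those to [P]; then [O1] with the other
   copy of those to [S]; last the remaining copies of those to [P], even at the owners and 1 at the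
   owned vertices. *)
apply: eq_decomp (decompD (decompD
   (decomp1 (w := fun u v => 2 * O2 u v + ((2 * (v \in C u) + (v \in P u))
                      + (2 * (u \in C v) + (u \in P v)))) _)
   (decomp1 (w := fun u v => 2 * O1 u v + ((v \in S u) + (u \in S v))) _))
   (decomp1 (w := fun u v => 0 + (((v \in P u) && (v \notin S u))
                      + ((u \in P v) && (u \notin S v)))) _)) => [u v|||].
- have eO : 2 * O u v = 2 * O2 u v + 2 * O1 u v.
    by rewrite /O1 /O2; case: (O u v); case: (_ || _).
  have eU a b : 2 * U a b = 2 * (b \in C a) + (b \in P a) + (b \in S a)
       + ((b \in P a) && (b \notin S a)).
    rewrite /U; case hC: (b \in C a); case hP: (b \in P a) => /=.
    + by case: (disj _ _ hC hP).
    + by case hS: (b \in S a) => //; rewrite (SPa _ _ hS) in hP.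
    + by case hS: (b \in S a).
    by case hS: (b \in S a) => //; rewrite (SPa _ _ hS) in hP.
  rewrite mulnDr eO !eU; lia.
- pose D u v := 2 * (v \in C u) + (v \in P u).
  have degD v : wdeg D v = 2 * (y2 v + (if v \in A1 then n v else 0)).
    have [_ cC _] := CP v.
    by rewrite wdegD wdeg_mul /wdeg !sum_in cC cP mulnDr.
  have degI v : wdeg (fun u v => 2 * O2 u v) v = 2 * deg O2 v.
    by rewrite wdeg_mul degE.
  have DU a b : 0 < D a b -> U a b.
    by rewrite /D /U; case: (b \in C a); case: (b \in P a).
  apply: (@robust_sided false _ D) => [u v|u v|u v /DU/orP[/CX|/PX]|a b _|a b Dab|u v] //.
  + by rewrite O2s.
  + by rewrite muln_gt0 /= lt0b => /andP[/OA].
  + by rewrite degD degI -mulnDr mul2n odd_double.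
  + have [c bc] : exists c, b \in P c by have /orP[/CB|h] := DU _ _ Dab; last by exists a.
    by rewrite /D big_split -big_distrr /= (sum_private Pd bc) mul2n oddD odd_double.
  rewrite !degD !degI muln_gt0 /= lt0b => huv; have /andP[_ h] := huv.
  case/orP: h => h; first by have := y2P u v h huv; rewrite /base2; lia.
  by rewrite O2s in huv; have := y2P v u h huv; rewrite /base2; lia.
- pose D u v := (v \in S u : nat).
  have degD v : wdeg D v = 2 * y1 v by rewrite /wdeg sum_in; have [_] := SP v.
  have degI v : wdeg (fun u v => 2 * O1 u v) v = 2 * deg O1 v.
    by rewrite wdeg_mul degE.
  apply: (@robust_sided false _ D) => [u v|u v|u v|a b _|a b|u v] //.
  + by rewrite O1s.
  + by rewrite muln_gt0 /= lt0b => /andP[/OA].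
  + by rewrite /D lt0b => /SPa/PX.
  + by rewrite degD degI -mulnDr mul2n odd_double.
  + by rewrite /D lt0b => h; rewrite (sum_private Sd h).
  rewrite !degD !degI muln_gt0 /= lt0b => huv; have /andP[Ouv nA2] := huv.
  have A1P v' : hi v' -> v' \notin A2 -> v' \in A1.
    by rewrite !inE => ->; rewrite andbT negbK.
  move: nA2; rewrite negb_or => /andP[u2 v2]; case/orP: (Ohi Ouv) => h.
    by have := y1P u v (A1P _ h u2) huv; lia.
  by rewrite O1s in huv; have := y1P v u (A1P _ h v2) huv; lia.
pose D u v := ((v \in P u) && (v \notin S u) : nat).
have degD v : wdeg D v = 2 * ((if v \in A1 then n v else 0) - y1 v).
  have [SPv cS] := SP v; rewrite mulnBr -cP -cS -cardsDS //.
  rewrite /wdeg -sum1_card [RHS]big_mkcond; apply: eq_bigr => u _.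
  by rewrite inE andbC /D andbC; case: ifP.
apply: (@robust_sided false (fun _ _ => 0) D) => [u v|u v|u v|a b _|a b|u v] //.
- by rewrite /D lt0b => /andP[/PX].
- by rewrite degD /wdeg big1 // add0n mul2n odd_double.
rewrite /D lt0b => /andP[bP bS].
have -> // : \sum_u ((b \in P u) && (b \notin S u) : nat) = 1.
rewrite -(sum_private Pd bP); apply: eq_bigr => u _.
case: (boolP (b \in P u)) => //= bu; case: (boolP (b \in S u)) => // bSu.
by move: bS; rewrite (Pd _ _ _ bP bu) bSu.
Qed.

End Palette.

(* One end of each edge of the matching M puts its edges to the outside in red,
   the other one in blue, and the edge of M takes both colours. *)
Lemma palette_matching (V : finType) (A : pred V) (X M : rel V) :
  (forall a b, X a b -> A a && ~~ A b) -> symmetric M -> irreflexive M ->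
  (forall u v, M u v -> A u && A v) ->
  (forall u v x, M u v -> M u x -> x = v) ->
  (forall u v, M u v -> exists b, X u b) ->
  let U u v := X u v && [exists x, M u x] in
  decomp (robust A) 2 (fun u v => 2 * M u v + 2 * (U u v + U v u)).
Proof.
move=> XA Ms Mi MA Mu MX U.
pose F u := [exists v, M u v && (enum_rank u < enum_rank v)].
have FM u v : M u v -> F u = ~~ F v.
  have FE a b : M a b -> F a = (enum_rank a < enum_rank b).
    move=> Mab; apply/existsP/idP => [[x /andP[Max]]|h]; last by exists b; rewrite Mab.
    by rewrite (Mu _ _ _ Mab Max).
  move=> Muv; have Mvu : M v u by rewrite Ms.
  rewrite (FE _ _ Muv) (FE _ _ Mvu) -leqNgt ltn_neqAle.
  have -> // : enum_rank u != enum_rank v :> nat.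
  by apply: contraTneq Muv => /val_inj/enum_rank_inj ->; rewrite Mi.
have degM u v : M u v -> wdeg (fun a b => M a b : nat) u = 1.
  move=> Muv; rewrite /wdeg (bigD1 v) //= Muv big1 // => x xv.
  by case h: (M u x) => //; rewrite (Mu _ _ _ Muv h) eqxx in xv.
(* [Q] selects one end of each edge of [M]. Ends of [M] get degree 1 plus doubled edges, which is
   odd, against even degrees outside; only the selected end exceeds 1. *)
have key (Q : pred V) : (forall u v, M u v -> Q u = ~~ Q v) ->
   robust A (fun u v => M u v + (2 * (U u v && Q u) + 2 * (U v u && Q v))).
  move=> QM; pose D u v := 2 * (U u v && Q u).
  apply: (@robust_sided _ _ X XA true (fun u v => M u v) D) => [u v|u v|u v|a b|a b _|u v].
  - by rewrite Ms.
  - by rewrite lt0b => /MA.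
  - by rewrite muln_gt0 /= lt0b => /andP[/andP[]].
  - rewrite muln_gt0 /= lt0b => /andP[/andP[_ /existsP[x Max]] _].
    by rewrite (degM _ _ Max) /D wdeg_mul oddD mul2n odd_double.
  - by rewrite -big_distrr /= mul2n odd_double.
  rewrite lt0b => Muv; have Mvu : M v u by rewrite Ms.
  rewrite (degM _ _ Muv) (degM _ _ Mvu).
  have zero a : Q a = false -> wdeg D a = 0.
    by move=> Qa; rewrite /wdeg big1 // => b _; rewrite /D Qa andbF.
  have pos a b : M a b -> Q a -> 0 < wdeg D a.
    move=> Mab Qa; have [c Xac] := MX _ _ Mab; apply: (@wdeg_gt0 _ _ a c).
    rewrite /D /U Qa Xac muln_gt0 /= lt0b andbT.
    by apply/existsP; exists b.
  have := QM _ _ Muv; case Qu: (Q u); case Qv: (Q v) => // _.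
    by have := pos _ _ Muv Qu; rewrite (zero v Qv); lia.
  by have := pos _ _ Mvu Qv; rewrite (zero u Qu); lia.
apply: eq_decomp (decompD (decomp1 (key F FM)) (decomp1 (key (predC F) _))) => [u v|u v /FM].
  by rewrite /=; case: (F u); case: (F v); rewrite ?andbT ?andbF /=; lia.
by rewrite /= => ->; rewrite negbK.
Qed.

(** * The partition of the vertices *)

Section Assembly.
Variable V : finType.
Implicit Types (r : rel V).

Lemma ord3P (i j : 'I_3) : [\/ j = i, j = ordS i | j = ordS (ordS i)].
Proof.
suff : [|| j == i, j == ordS i | j == ordS (ordS i)].
  by case/or3P => /eqP; [constructor 1|constructor 2|constructor 3].
by case: i => [[|[|[|]]] //] ?; case: j => [[|[|[|]]] //] ?; rewrite -!val_eqE.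
Qed.

Lemma ordS3_neq (i : 'I_3) : (ordS i == i) = false.
Proof. by case: i => [[|[|[|]]] //] ?; rewrite -val_eqE. Qed.

Lemma ordSS3_neq (i : 'I_3) : (ordS (ordS i) == i) = false.
Proof. by case: i => [[|[|[|]]] //] ?; rewrite -val_eqE. Qed.

Lemma ordSSS3 (i : 'I_3) : ordS (ordS (ordS i)) = i.
Proof. by apply: val_inj; case: i => [[|[|[|]]] //] ?. Qed.

Definition forward (e : rel V) (f : V -> 'I_3) : rel V :=
  fun u v => e u v && (f v == ordS (f u)).

Definition inner (e : rel V) (f : V -> 'I_3) : rel V :=
  fun u v => e u v && (f v == f u).

(* A locally optimal partition in three parts, modified by putting the leaves
   in the part which follows the one of their neighbour. *)
Lemma cyclic_partition (e : rel V) : symmetric e -> irreflexive e ->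
  no_isolated_edge e -> exists f : V -> 'I_3,
  (forall v, deg (inner e f) v <= deg (forward e f) v) /\
  (forall a b, forward e f a b -> deg (forward e f) a <= 1 ->
     exists w, forward e f w a).
Proof.
move=> es ei en; have [f0 f0P] := local_cut (@ord0 2) es ei.
pose leaf v := deg e v <= 1.
pose f v := if leaf v then (if [pick u | e v u] is Some u then ordS (f0 u) else f0 v)
            else f0 v.
have fnl v : ~~ leaf v -> f v = f0 v by rewrite /f => /negbTE ->.
have leafP v u : leaf v -> e v u -> ~~ leaf u /\ f v = ordS (f u).
  move=> lv evu; have nlu : ~~ leaf u.
    apply/negP => lu; have [x [/andP[h /eqP[]]|/andP[h /eqP[]]]] := en v u evu.
      exact: deg_le1 h evu.
    by apply: (deg_le1 lu h); rewrite es.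
  split=> //; rewrite (fnl _ nlu) /f lv; case: pickP => [x evx|/(_ u)]; last by rewrite evu.
  by rewrite (deg_le1 lv evx evu).
exists f; split=> [v|a b].
  case: (boolP (leaf v)) => [lv|nlv].
    have -> // : deg (inner e f) v = 0.
    apply: eq_card0 => u; rewrite inE /inner; apply/andP => -[evu].
    by have [_ ->] := leafP _ _ lv evu; rewrite eq_sym ordS3_neq.
  apply: leq_trans (leq_trans _ (f0P v (ordS (f0 v)))) _.
    apply/subset_leq_card/subsetP => u; rewrite !inE /inner => /andP[evu].
    rewrite evu (fnl v) //=; case: (boolP (leaf u)) => [lu|/fnl ->] //.
    have evu' := evu; rewrite es in evu'.
    by have [_ ->] := leafP _ _ lu evu'; rewrite (fnl v) // ordS3_neq.
  apply/subset_leq_card/subsetP => u; rewrite !inE /forward => /andP[evu].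
  rewrite evu (fnl v) //=; case: (boolP (leaf u)) => [lu|/fnl ->] // _.
  have evu' := evu; rewrite es in evu'.
  by have [_ ->] := leafP _ _ lu evu'; rewrite (fnl v).
move=> /andP[eab /eqP fab] da.
have Xab x : forward e f a x -> x = b.
  by move=> h; apply: (deg_le1 da) => //; rewrite /forward eab fab eqxx.
have nla : ~~ leaf a.
  apply/negP => la; have [_ h] := leafP _ _ la eab.
  by have := ordSS3_neq (f b); rewrite -h -fab eqxx.
have [|c eac cb] := @deg_gt1 V e a _ b; first by rewrite ltnNge.
have back x : e a x -> f x = ordS (ordS (f a)) -> exists w, forward e f w a.
  by move=> eax fx; exists x; rewrite /forward es eax fx ordSSS3 /=.
(* If [c] lies in the part of [a], optimality of [f0] gives [a] neighbours in both other parts. The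
   one ahead must be [b]; the one behind is then no leaf, since a leaf would have been moved ahead
   and be [b] too. *)
case: (ord3P (f a) (f c)) => fc; last exact: back eac fc.
  have nlc : ~~ leaf c.
    apply/negP => lc; have eca := eac; rewrite es in eca.
    by have [_ h] := leafP _ _ lc eca; have := ordS3_neq (f a); rewrite -h fc eqxx.
  have own : 0 < deg (fun u x => e u x && (f0 x == f0 u)) a.
    by apply: (@deg_gt0 _ _ _ c); rewrite eac -(fnl c) // -(fnl a) // fc eqxx.
  have /card_gt0P[z] := leq_trans own (f0P a (ordS (f0 a))).
  rewrite inE => /andP[eaz /eqP fz].
  have /card_gt0P[z'] := leq_trans own (f0P a (ordS (ordS (f0 a)))).
  rewrite inE => /andP[eaz' /eqP fz'].
  have fwd_leaf x : e a x -> leaf x -> x = b.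
    move=> eax lx; have exa := eax; rewrite es in exa.
    by apply: Xab; rewrite /forward eax; have [_ ->] := leafP _ _ lx exa; rewrite eqxx.
  have zb : z = b.
    case: (boolP (leaf z)) => [/(fwd_leaf _ eaz)//|nlz].
    by apply: Xab; rewrite /forward eaz (fnl z) // (fnl a) // fz eqxx.
  case: (boolP (leaf z')) => [/(fwd_leaf _ eaz') z'b|nlz'].
    by have := ordS3_neq (ordS (f0 a)); rewrite -fz' z'b -zb fz eqxx.
  by apply: back eaz' _; rewrite (fnl z') // (fnl a).
by case/eqP: cb; apply: Xab; rewrite /forward eac fc eqxx.
Qed.

Lemma deg_isolated r v : symmetric r -> deg (isolated_edge r) v <= 1.
Proof.
move=> rs; apply/card_le1_eqP => x x'; rewrite !inE.
by move=> /(isolated_edgeP rs)[_ h _] /(isolated_edgeP rs)[/h].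
Qed.

Lemma deg_isolated_family (I : finType) (r : I -> rel V) v :
  (forall i, symmetric (r i)) ->
  deg (fun u x => [exists i, isolated_edge (r i) u x]) v <= #|I|.
Proof.
move=> rs; rewrite -sum1_card.
apply: leq_trans (leq_sum _ (fun i _ => deg_isolated v (rs i))).
rewrite degE; under [leqRHS]eq_bigr do rewrite degE.
rewrite exchange_big /=; apply: leq_sum => x _.
by case: existsP => // -[i h]; rewrite (bigD1 i) //= h.
Qed.

(* The edges between the 32 = 2 ^ 5 parts of a local cut form 5 bipartite
   graphs, whose isolated edges go to [O] when they have an end with [20 <= d].
   There the degree in [O] is at most [k + 5] with [32 * k <= d]. The edges left
   have degree at most 5, whence 41 = 5 * 3 + (5 * 5).+1 colours. *)
Lemma split_inner (r : rel V) (d : V -> nat) : symmetric r -> irreflexive r ->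
  (forall v, deg r v <= d v) ->
  exists (O M : rel V) (m : V -> V -> nat),
    [/\ symmetric O /\ symmetric M,
        forall u v, O u v || M u v -> r u v,
        forall u v, O u v -> (20 <= d u) || (20 <= d v),
        forall v, 20 <= d v -> deg O v <= d v %/ 4 &
    [/\ forall u v x, M u v -> M u x -> x = v,
        forall u v, M u v -> d u < 20,
        decomp (@irregular V) 41 m &
        forall u v, 2 * r u v = m u v + 2 * O u v + 2 * M u v]].
Proof.
move=> rs ri rd.
have [g gP] := local_cut [ffun=> false : bool] rs ri (K := {ffun 'I_5 -> bool}).
(* An edge between two parts is assigned a coordinate in which they differ; [None] marks the edges
   inside a part. *)
pose bit u v := [pick c | g u c != g v c].
have bitC u v : bit u v = bit v u by apply: eq_pick => c; rewrite /= eq_sym.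
pose own u v := r u v && (g v == g u).
pose W c u v := r u v && (bit u v == Some c).
have Ws c : symmetric (W c) by move=> u v; rewrite /W rs bitC.
have bitP u v : own u v = r u v && (bit u v == None).
  rewrite /own /bit; case: (r u v) => //=; case: pickP => [c /eqP ne|eq].
    by apply/eqP => e; rewrite e in ne.
  by apply/eqP/ffunP => c; apply/esym/eqP; have := eq c => /= /negbFE.
pose WK u v := [exists c, isolated_edge (W c) u v].
have WKs : symmetric WK.
  by move=> u v; apply: eq_existsb => c; rewrite isolated_edge_sym.
have WKr u v : WK u v -> r u v && ~~ own u v.
  by case/existsP=> c /(isolated_edgeP (Ws c))[/andP[h /eqP e] _ _]; rewrite bitP h e.
have WK5 v : deg WK v <= 5 by rewrite -[leqRHS](card_ord 5); apply: deg_isolated_family.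
pose hi v := 20 <= d v.
pose O u v := own u v || WK u v && (hi u || hi v).
(* Isolated edges with two low ends: those isolated again form the matching [M], the others are
   split into stars. *)
pose LL u v := WK u v && ~~ (hi u || hi v).
have owns : symmetric own by move=> u v; rewrite /own rs eq_sym.
have LLs : symmetric LL by move=> u v; rewrite /LL WKs orbC.
have LLi : irreflexive LL by move=> u; apply/negP => /andP[/WKr]; rewrite ri.
have LL5 v : deg (core LL) v <= 5.
  apply: leq_trans (WK5 v); apply/subset_leq_card/subsetP => u.
  by rewrite !inE => /andP[/andP[]].
have own32 v : 32 * deg own v <= d v.
  apply: leq_trans (rd v); have := local_cut_card (gP v).
  by rewrite card_ffun card_bool card_ord.
exists O, (isolated_edge LL).
exists (fun u v => \sum_c 2 * core (W c) u v + 2 * core LL u v); split.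
- split; last exact: isolated_edge_sym.
  by move=> u v; rewrite /O owns WKs (orbC (hi u)).
- move=> u v /orP[/orP[/andP[]//|/andP[/WKr/andP[]//]]|].
  by case/(isolated_edgeP LLs) => /andP[/WKr/andP[]].
- move=> u v /orP[h|/andP[] //]; have := own32 u.
  have : 0 < deg own u by apply: deg_gt0 h.
  by lia.
(* This fixes the threshold 20: below 32 no edge of [own] meets [v], and [5 <= d v %/ 4] amounts to
   [20 <= d v]. *)
- move=> v hv; have : deg O v <= deg own v + deg WK v.
    rewrite !degE -big_split; apply: leq_sum => u _; rewrite /O.
    by case: (own v u); case: (WK v u) => //=; case: (_ || _).
  by have := own32 v; have := WK5 v; lia.
split.
- by move=> u v x /(isolated_edgeP LLs)[_ h _] /(isolated_edgeP LLs)[/h].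
- move=> u v /(isolated_edgeP LLs)[/andP[_]].
  by rewrite negb_or -ltnNge => /andP[].
- have -> : 41 = size (index_enum 'I_5) * 3 + (5 * 5).+1.
    by rewrite -[index_enum _]/(Finite.enum _) -enumT size_enum_ord.
  apply: decompD; last first.
    apply: star_decomp LL5; [exact: core_sym|by move=> u; rewrite /core LLi|exact: core_no_isolated].
  apply: decomp_sum => c; apply: (bipartite_decomp (s := fun v => g v c)).
  + exact: core_sym.
  + move=> u v /andP[/andP[_]]; rewrite /bit; case: pickP => // d' h /eqP[<-] _ //.
  exact: core_no_isolated.
move=> u v; have eW : r u v = \sum_c core (W c) u v + own u v + WK u v :> nat.
  case ruv: (r u v); last first.
    rewrite big1 => [|c _]; last by rewrite /core /W ruv.
    by rewrite /own ruv; case h: (WK u v) => //; have := WKr _ _ h; rewrite ruv.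
  case b: (bit u v) => [c|]; last first.
    rewrite big1 => [|c _]; last by rewrite /core /W b andbF.
    have o : own u v by rewrite bitP ruv b.
    by rewrite o; case h: (WK u v) => //; have := WKr _ _ h; rewrite o andbF.
  have -> : own u v = false by rewrite bitP b andbF.
  have other c' : c' != c -> W c' u v = false.
    by rewrite /W b => ne; apply/negbTE; rewrite negb_and -[_ == _]/(c == c') eq_sym ne orbT.
  have Wc : W c u v by rewrite /W ruv b eqxx.
  rewrite (bigD1 c) //= big1 => [|c' /other h]; last by rewrite /core h.
  have -> : WK u v = isolated_edge (W c) u v.
    apply/existsP/idP => [[c']|h]; last by exists c.
    by case: (c' =P c) => [->//|/eqP/other h /(isolated_edgeP (Ws _))[]]; rewrite h.
  by rewrite /core Wc; case: (isolated_edge _ _ _).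
rewrite -big_distrr /= eW /core /LL /O.
have := WKr u v; have isoLL : isolated_edge LL u v -> LL u v by case/and3P.
move: isoLL; rewrite /LL; case: (WK u v); case: (own u v); case: (hi u || hi v);
  case: (isolated_edge _ _ _); rewrite ?andbF //=; lia.
Qed.

End Assembly.

(** * The decomposition of the doubled graph *)

Section DoubledGraph.
Variables (V : finType) (e : rel V).
Hypotheses (es : symmetric e) (ei : irreflexive e) (en : no_isolated_edge e).

(* The count is 75 = 3 * 3 + 3 * 5 + 41 + (3 * 3).+1: the bipartite graphs and
   the palettes of the three parts, the inner edges, and [core L]. *)
Lemma decomp_double : decomp (@irregular V) 75 (fun u v => 2 * e u v).
Proof.
have [f [F1 F2]] := cyclic_partition es ei en.
pose X := forward e f; pose inn := inner e f.
have inns : symmetric inn by move=> u v; rewrite /inn /inner es eq_sym.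
have inni : irreflexive inn by move=> u; rewrite /inn /inner ei.
have eX u v : e u v = inn u v + X u v + X v u :> nat.
  rewrite /inn /inner /X /forward (es v u); case: (e u v) => //=.
  have n1 (i : 'I_3) : (i == ordS i) = false by rewrite eq_sym ordS3_neq.
  have n2 (i : 'I_3) : (i == ordS (ordS i)) = false by rewrite eq_sym ordSS3_neq.
  by case: (ord3P (f u) (f v)) => ->;
     rewrite ?ordSSS3 ?eqxx ?ordS3_neq ?ordSS3_neq ?n1 ?n2.
have Xf u v : X u v -> f v = ordS (f u) by case/andP=> _ /eqP.
have ordS_inj : injective (@ordS 3) by apply: can_inj (@ordSK 3).
have [O [M [m [[Os Ms] OMr Ohi hiO [Mu Mlow mdec mE]]]]] := split_inner inns inni F1.
have Oinn u v : O u v -> inn u v by move=> h; apply: OMr; rewrite h.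
have Minn u v : M u v -> inn u v by move=> h; apply: OMr; rewrite h orbT.
pose hi v := 20 <= deg X v.
pose A (i : 'I_3) v := f v == i.
pose Xi i u v := X u v && (f u == i); pose Oi i u v := O u v && (f u == i).
pose Mi i u v := M u v && (f u == i); pose hii i v := hi v && (f v == i).
have XA i a b : Xi i a b -> A i a && ~~ A i b.
  by case/andP=> /Xf h /eqP <-; rewrite /A eqxx h ordS3_neq.
have inA i r u v : subrel r inn -> r u v && (f u == i) -> A i u && A i v.
  by move=> sub /andP[/sub/andP[_ /eqP h] /eqP <-]; rewrite /A h eqxx.
have symi i r : symmetric r -> subrel r inn -> symmetric (fun u v => r u v && (f u == i)).
  move=> rs sub u v; rewrite rs; case h: (r v u) => //=.
  by have /andP[_ /eqP ->] := sub _ _ h.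
have degXi i v : f v = i -> deg (Xi i) v = deg X v.
  by move=> fv; apply: eq_card => u; rewrite !inE /Xi fv eqxx andbT.
have /fin_all_exists[U UP] : forall i, exists U : rel V,
  [/\ forall a b, U a b -> Xi i a b && hii i a,
      forall a, hii i a -> deg U a <= deg (Xi i) a %/ 2 &
      decomp (robust (A i)) 3 (fun u v => 2 * Oi i u v + 2 * (U u v + U v u))].
  move=> i; apply: palette_high => [|||u v|u v|v].
  - exact: XA.
  - exact: symi.
  - by move=> u; rewrite /Oi; case h: (O u u) => //; have := Oinn _ _ h; rewrite inni.
  - exact: inA.
  - move=> h; have /andP[/eqP fu /eqP fv] := inA i O u v Oinn h.
    by rewrite /hii fu fv eqxx !andbT; case/andP: h => /Ohi.
  move=> /andP[hv /eqP fv]; rewrite (degXi _ _ fv); apply: leq_trans (hiO v hv).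
  by apply/subset_leq_card/subsetP => u; rewrite !inE => /andP[].
(* [B] takes every forward edge at an end of [M], whereas [U] takes at most half of those at a high
   vertex. *)
pose B i u v := Xi i u v && [exists x, Mi i u x].
have Bdec i : decomp (robust (A i)) 2 (fun u v => 2 * Mi i u v + 2 * (B i u v + B i v u)).
  apply: palette_matching => [|||u v|u v x|u v].
  - exact: XA.
  - exact: symi.
  - by move=> u; rewrite /Mi; case h: (M u u) => //; have := Minn _ _ h; rewrite inni.
  - exact: inA.
  - by move=> /andP[h _] /andP[h' _]; apply: Mu h h'.
  move=> /andP[h /eqP fu]; have := leq_trans (deg_gt0 (Minn _ _ h)) (F1 u).
  by case/card_gt0P => b; rewrite inE => hb; exists b; rewrite /Xi /X hb fu eqxx.
pose P i u v := 2 * Oi i u v + 2 * (U i u v + U i v u)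
                + (2 * Mi i u v + 2 * (B i u v + B i v u)).
have Pdec i : decomp (robust (A i)) 5 (P i).
  by have [_ _ h] := UP i; apply: (decompD h (Bdec i)).
have UX i a b : U i a b -> Xi i a b by have [h _ _] := UP i => /h/andP[].
have Uhi i a b : U i a b -> hi a by have [h _ _] := UP i => /h/andP[_ /andP[]].
have Blow i a b : B i a b -> hi a = false.
  by move=> /andP[_ /existsP[x /andP[/Mlow h _]]]; apply/negbTE; rewrite -ltnNge.
(* The edges left to the bipartite graphs between consecutive parts. *)
pose Y i u v := [&& Xi i u v, ~~ U i u v & ~~ B i u v].
pose Ys i u v := Y i u v || Y i v u.
have Yss i : symmetric (Ys i) by move=> u v; rewrite /Ys orbC.
have YX i a b : Y i a b -> Xi i a b by case/and3P.
have Xif i a b : Xi i a b -> f a = i /\ f b = ordS i.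
  by case/andP=> /Xf -> /eqP ->.
have XiN i a b : Xi i a b -> Xi i b a = false.
  move=> /Xif[fa fb]; apply/negP => /Xif[fb' _].
  by have := ordS3_neq i; rewrite -fb -[in X in _ == X]fb' eqxx.
have YsX a b i : X a b -> Ys i a b -> Y i a b && (f a == i).
  move=> Xab /orP[h|/YX/Xif[fb fa]]; first by rewrite h; have [-> _] := Xif _ _ _ (YX _ _ _ h); rewrite eqxx.
  by have := ordSS3_neq i; rewrite -fa -(Xf _ _ Xab) fb eqxx.
pose L u v := [exists i, isolated_edge (Ys i) u v].
have Ls : symmetric L by move=> u v; apply: eq_existsb => i; rewrite isolated_edge_sym.
have YsiF i : irreflexive (Ys i).
  by move=> u; rewrite /Ys orbb; apply/negP => /YX/andP[/andP[]]; rewrite ei.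
(* The tail [a] is low, since [U] leaves a high vertex at least half of its forward edges. At a low
   vertex only [B] takes forward edges, all or none, so [b] is the only forward neighbour of [a]. *)
have LX a b : L a b -> X a b ->
    [/\ isolated_edge (Ys (f a)) a b, Y (f a) a b & deg X a <= 1].
  move=> /existsP[i iso] Xab; have [yab onlyb _] := isolated_edgeP (Yss i) iso.
  have /andP[Yab /eqP fa] := YsX _ _ _ Xab yab; rewrite fa; split=> //.
  have [Xiab nU nB] := and3P Yab.
  have hia : hi a = false.
    apply/negP => ha; have ha' : hii i a by rewrite /hii ha fa eqxx.
    have [_ /(_ a ha') leU _] := UP i.
    have : deg (Xi i) a <= deg (U i) a + 1.
      rewrite -(cards1 b) -cardsUI; apply: leq_trans (leq_addr _ _).
      apply/subset_leq_card/subsetP => x; rewrite !inE => Xax.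
      case: (boolP (U i a x)) => //= nUx; apply/eqP/onlyb.
      rewrite /Ys /Y Xax nUx /=; case: (boolP (B i a x)) => // /Blow.
      by rewrite ha.
    by move: leU; rewrite (degXi _ _ fa); move: ha; rewrite /hi; lia.
  apply/card_le1_eqP => x x'.
  suff only z : X a z -> z = b by rewrite !inE => /only -> /only ->.
  move=> Xaz; apply: onlyb; rewrite /Ys /Y; have -> : Xi i a z by rewrite /Xi Xaz fa eqxx.
  have -> : U i a z = false by apply/negP => /Uhi; rewrite hia.
  have -> // : B i a z = false.
  move: nB; rewrite /B Xiab /= => /negbTE ->; exact: andbF.
have L3 v : deg (core L) v <= 3.
  apply: (@leq_trans (deg L v)).
    by apply/subset_leq_card/subsetP => u; rewrite !inE => /andP[].
  by rewrite -[leqRHS](card_ord 3); apply: deg_isolated_family.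
have Li : irreflexive L.
  by move=> u; apply/existsP => -[i] /(isolated_edgeP (Yss i))[]; rewrite YsiF.
pose Z u v := isolated_edge L u v && X u v.
have Zu u v x : Z u v -> L u x -> x = v.
  by move=> /andP[/(isolated_edgeP Ls)[_ h _] _]; apply: h.
have ZL u v : Z u v -> L u v by move=> /andP[/(isolated_edgeP Ls)[]].
have ZX u v : Z u v -> X u v by case/andP.
(* An isolated edge (a, b) of L is attached to an edge entering a: one of the
   bipartite graph when possible, otherwise one used by the palettes. *)
pose alpha j a b := [&& Z a b, f a == ordS j & [exists w, Y j w a]].
pose beta j a b := [&& Z a b, f a == ordS j & ~~ [exists w, Y j w a]].
have Zf j a b : Z a b -> f a == ordS j -> f b = ordS (ordS j).
  by move=> /ZX/Xf -> /eqP ->.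
pose y j u v := core (Ys j) u v || (alpha j u v || alpha j v u).
have ys j : symmetric (y j).
  by move=> u v; rewrite /y core_sym // (orbC (alpha j u v)).
(* [Ys j] joins the parts [j] and [ordS j], and [alpha j] joins [ordS j] to the next one: the part
   [ordS j] is one side. *)
have yside j u v : y j u v -> (f u == ordS j) != (f v == ordS j).
  have neq : (j == ordS j) = false by rewrite eq_sym ordS3_neq.
  case/orP=> [/andP[/orP[]/YX/Xif[-> ->] _]|/orP[]/and3P[h fa _]].
  - by rewrite eqxx neq.
  - by rewrite eqxx neq.
  - by rewrite fa (Zf _ _ _ h fa) ordS3_neq.
  by rewrite fa (Zf _ _ _ h fa) ordS3_neq.
have alphaw j a b : alpha j a b -> exists w, core (Ys j) a w && (w != b).
  move=> /and3P[h fa /existsP[w Yw]]; exists w.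
  have [fw _] := Xif _ _ _ (YX _ _ _ Yw).
  have wb : w != b.
    by apply/eqP => wb; have := ordSS3_neq j; rewrite -(Zf _ _ _ h fa) -wb fw eqxx.
  (* If the edge from [w] to [a] were isolated in [Ys j], it would lie in [L] and meet an isolated
     edge of [L]. *)
  rewrite wb andbT /core /Ys Yw orbT /=; apply/negP => iso.
  by case/eqP: wb; apply: (Zu _ _ _ h); apply/existsP; exists j.
have yn j : no_isolated_edge (y j).
  move=> u v /orP[h|/orP[h|h]].
  - have [x hx] := core_no_isolated (Yss j) h; exists x.
    by case: hx => /andP[hx ->]; [left|right]; rewrite /y hx.
  - by have [w /andP[hw ne]] := alphaw _ _ _ h; exists w; left; rewrite /y hw ne.
  by have [w /andP[hw ne]] := alphaw _ _ _ h; exists w; right; rewrite /y hw ne.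
have ydec j : decomp (@irregular V) 3 (fun u v => 2 * y j u v).
  exact: bipartite_decomp (ys j) (@yside j) (@yn j).
have bdec j : decomp (@irregular V) 5 (fun u v => P j u v + 2 * (beta j u v + beta j v u)).
  apply: attach_pendants (Pdec j) _ _ _ => [a b|a b b'|a a' b].
  - move=> /and3P[h /eqP fa nw]; have fb := Zf _ _ _ h (introT eqP fa).
    have [_ _ da] := LX _ _ (ZL _ _ h) (ZX _ _ h).
    (* A forward edge enters [a]; not being in [Y j], it is used by the palettes of part [j]. These
       do not reach [b], which lies in the third part. *)
    have [w Xwa] := F2 _ _ (ZX _ _ h) da.
    have Xj : Xi j w a.
      by rewrite /Xi /X Xwa; apply/eqP/ordS_inj; rewrite -fa -(Xf _ _ Xwa).
    split; first by rewrite /A fa ordS3_neq.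
      exists w; move/existsPn: nw => /(_ w); rewrite /Y Xj /= negb_and !negbK /P.
      by case/orP=> ->; lia.
    move=> u; have nAb : f b == j = false by rewrite fb ordSS3_neq.
    have Xbu : Xi j b u = false by apply/negP => /XA; rewrite /A nAb.
    have Xub : Xi j u b = false.
      by apply/negP => /Xif[_]; rewrite fb => /eqP; rewrite ordS3_neq.
    have -> // : P j b u = 0.
    rewrite /P /Oi /Mi /B nAb Xbu Xub !andbF /=.
    have -> : U j b u = false by apply/negP => /UX; rewrite Xbu.
    by have -> : U j u b = false by apply/negP => /UX; rewrite Xub.
  - by move=> /and3P[h _ _] /and3P[/ZL h' _ _]; rewrite (Zu _ _ _ h h').
  move=> /and3P[/andP[/(isolated_edgeP Ls)[_ _ h] _] _ _] /and3P[/ZL h' _ _].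
  by apply/esym/h; rewrite Ls.
(* Every forward edge goes to exactly one place: a bipartite graph, [core L], a palette, or, if
   isolated in [L], to some [alpha j] or [beta j]. *)
have XE u v : X u v = \sum_j (Y j u v && core (Ys j) u v) + (X u v && core L u v)
     + \sum_j alpha j u v + \sum_j beta j u v + \sum_j U j u v + \sum_j B j u v :> nat.
  case Xuv: (X u v); last first.
    have Xi0 i : Xi i u v = false by rewrite /Xi Xuv.
    have Z0 : Z u v = false by rewrite /Z Xuv andbF.
    rewrite !big1 => [|i _|i _|i _|i _|i _] //; rewrite ?/B ?/alpha ?/beta ?/Y ?Xi0 ?Z0 //.
    by apply/eqP; rewrite eqb0; apply/negP => /UX; rewrite Xi0.
  have fv := Xf _ _ Xuv; pose i := f u.
  have Xi0 j : j != i -> Xi j u v = false.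
    by rewrite /Xi Xuv eq_sym => /negbTE.
  have Xiuv : Xi i u v by rewrite /Xi Xuv eqxx.
  have U1 : \sum_j U j u v = U i u v :> nat.
    rewrite (bigD1 i) //= big1 ?addn0 // => j /Xi0 h.
    by apply/eqP; rewrite eqb0; apply/negP => /UX; rewrite h.
  have B1 : \sum_j B j u v = B i u v :> nat.
    by rewrite (bigD1 i) //= big1 ?addn0 // => j /Xi0 h; rewrite /B h.
  have Y1 : \sum_j (Y j u v && core (Ys j) u v) = (Y i u v && core (Ys i) u v) :> nat.
    by rewrite (bigD1 i) //= big1 ?addn0 // => j /Xi0 h; rewrite /Y h.
  have ab : \sum_j alpha j u v + \sum_j beta j u v = Z u v :> nat.
    have one j : alpha j u v + beta j u v = (Z u v && (f u == ordS j)) :> nat.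
      rewrite /alpha /beta; case: (Z u v) => //=; case: (f u == _) => //=.
      by case: [exists w, _].
    rewrite -big_split (eq_bigr _ (fun j _ => one j)) /=.
    rewrite (bigD1 (ordS (ordS i))) //= ordSSS3 eqxx andbT big1 ?addn0 // => j.
    move=> ne; case: (f u =P ordS j) => [h|_]; last by rewrite andbF.
    by case/eqP: ne; apply: ordS_inj; rewrite ordSSS3 -h.
  rewrite U1 B1 Y1 -!addnA (addnA (\sum_j alpha j u v)) ab /=.
  have LE : L u v = isolated_edge (Ys i) u v && Y i u v.
    apply/idP/andP => [h|[h _]]; last by apply/existsP; exists i.
    by have [] := LX _ _ h Xuv.
  have UB : U i u v && B i u v = false.
    by apply/negP => /andP[/Uhi h /Blow]; rewrite h.
  have Ysi : Y i u v -> Ys i u v by rewrite /Ys => ->.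
  have ZE : Z u v = isolated_edge L u v by rewrite /Z Xuv andbT.
  have isoL : isolated_edge L u v -> L u v by case/and3P.
  rewrite ZE /core; move: isoL Ysi; rewrite LE /Y Xiuv /=; move: UB.
  by case: (U i u v); case: (B i u v); case: (isolated_edge L u v);
    case: (isolated_edge (Ys i) u v); case: (Ys i u v) => //= _ h1 h2;
    do [by move: (h1 isT)|by move: (h2 isT)].
have yE j u v : y j u v = (Y j u v && core (Ys j) u v) + (Y j v u && core (Ys j) v u)
     + (alpha j u v + alpha j v u) :> nat.
  rewrite (core_sym (Yss j) v u) /y.
  have coreY : core (Ys j) u v = (Y j u v && core (Ys j) u v) || (Y j v u && core (Ys j) u v).
    by rewrite -andb_orl; case h: (core _ u v); rewrite ?andbF // andbT; case/andP: h.
  have YN : Y j u v && Y j v u = false.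
    by apply/negP => /andP[/YX/XiN h /YX]; rewrite h.
  have aN a b : alpha j a b -> alpha j b a = false.
    move=> /and3P[h fa _]; apply/negP => /and3P[_ fb _].
    by have := ordS3_neq (ordS j); rewrite -(Zf _ _ _ h fa) fb.
  have aY a b : alpha j a b -> core (Ys j) a b = false.
    move=> /and3P[h fa _]; have fb := Zf _ _ _ h fa.
    apply/negP => /andP[/orP[]/YX/Xif[f1 f2] _].
      by move: fa; rewrite f1 eq_sym ordS3_neq.
    by have := ordSS3_neq j; rewrite -fb f1 eqxx.
  case auv: (alpha j u v).
    by rewrite (aN _ _ auv) (aY _ _ auv) !andbF orbT.
  case avu: (alpha j v u).
    by have := aY _ _ avu; rewrite core_sym // => ->; rewrite !andbF.
  rewrite !orbF coreY; move: YN.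
  by case: (Y j u v); case: (Y j v u) => //=; rewrite ?andbT ?orbF ?addn0; case: (core _ _ _).
have LE u v : core L u v = (X u v && core L u v) + (X v u && core L v u) :> nat.
  rewrite (core_sym Ls v u); case h: (core L u v); rewrite ?andbF // !andbT.
  have /andP[/existsP[i /and3P[/orP[]/YX/andP[Xe _] _ _]] _] := h.
    have := eX u v; rewrite Xe; case: (X v u) => //; case: (e u v); lia.
  by have := eX u v; rewrite Xe; case: (X u v) => //; case: (e u v); lia.
have size3 : size (index_enum 'I_3) = 3.
  by rewrite -[index_enum _]/(Finite.enum _) -enumT size_enum_ord.
have Li' : irreflexive (core L) by move=> u; rewrite /core Li.
have := decompD (decompD (decompD (decomp_sum (index_enum 'I_3) ydec)
    (decomp_sum (index_enum 'I_3) bdec)) mdec)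
    (star_decomp (core_sym Ls) Li' (core_no_isolated Ls) L3).
rewrite size3; apply: eq_decomp => u v.
have sum_part (r : rel V) : \sum_i (r u v && (f u == i)) = r u v :> nat.
  rewrite (bigD1 (f u)) //= eqxx andbT big1 ?addn0 // => i.
  by rewrite eq_sym => /negbTE ->; rewrite andbF.
have -> : \sum_i 2 * y i u v = 2 * (\sum_i (Y i u v && core (Ys i) u v)
     + \sum_i (Y i v u && core (Ys i) v u)
     + (\sum_i alpha i u v + \sum_i alpha i v u)).
  by rewrite -big_distrr -!big_split /=; congr (_ * _); apply: eq_bigr => i _; rewrite yE.
have -> : \sum_i (P i u v + 2 * (beta i u v + beta i v u)) =
    2 * O u v + 2 * (\sum_i U i u v + \sum_i U i v u)
    + (2 * M u v + 2 * (\sum_i B i u v + \sum_i B i v u))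
    + 2 * (\sum_i beta i u v + \sum_i beta i v u).
  by rewrite -(sum_part O) -(sum_part M) !big_distrr /= -!big_split !big_distrr -!big_split.
have := mE u v; have := eX u v; rewrite (XE u v) (XE v u) LE; lia.
Qed.

End DoubledGraph.

(** * Colourings of the doubled graph *)

Lemma count_bool_nth (T : eqType) (x0 : T) (s : seq T) c : size s = 2 ->
  \sum_(b : bool) (nth x0 s b == c) = count_mem c s.
Proof.
case: s => [|a [|b []]] // _; rewrite (bigD1 false) //= (bigD1 true) //= big1 //.
by case.
Qed.

(** [w c u v] is the number of copies of the edge with colour [c]. These numbers add up to 2, so
    listing each colour with its multiplicity gives one colour for each copy. *)
Lemma colorable_of_decomp (G : sgraph) n :
  decomp (@irregular G) n.+1 (fun u v => 2 * sedge u v) ->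
  locally_irregular_colorable (double_graph G) n.+1.
Proof.
move=> [w [wi we]].
(* By symmetry of [w c] the chosen ordered pair does not matter; 0 is a dummy value for sets of
   another shape. *)
pose mult (c : 'I_n.+1) (E : {set G}) :=
  if [pick p : G * G | E == [set p.1; p.2]] is Some p then w c p.1 p.2 else 0.
have multE c u v : mult c [set u; v] = w c u v.
  have [ws _] := wi c; rewrite /mult; case: pickP => [[a b] /=|/(_ (u, v))]; last by rewrite /= eqxx.
  by rewrite set2_eq => /orP[]/andP[/eqP-> /eqP->] //; rewrite ws.
pose colors E := flatten [seq nseq (mult c E) c | c <- enum 'I_n.+1].
have count_colors c E : count_mem c (colors E) = mult c E.
  rewrite count_flatten -map_comp sumnE big_map big_enum (bigD1 c) //= count_nseq.
  rewrite /= eqxx mul1n big1 ?addn0 // => d dc.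
  by rewrite count_nseq /= (negbTE dc).
have edgeP (E : {set G}) : E \in edge_set G -> exists u v, sedge u v /\ E = [set u; v].
  by rewrite inE => /existsP[u /existsP[v /andP[h /eqP]]]; exists u, v.
have size_colors E : E \in edge_set G -> size (colors E) = 2.
  move=> /edgeP[u [v [uv ->]]]; rewrite size_flatten /shape -map_comp sumnE big_map big_enum /=.
  under eq_bigr do rewrite size_nseq multE.
  by have := we u v; rewrite uv => <-.
(* The boolean naming the copy is read as position 0 or 1. *)
pose col (x : medge (double_graph G)) := nth ord0 (colors (val x.1)) x.2.
exists col => c.
have degE v : @mdeg (edge_submultigraph (fun x => col x == c)) v = wdeg (w c) v.
  transitivity #|[set x : medge (double_graph G) | (col x == c) && (v \in val x.1)]|.
    rewrite /mdeg -(card_imset _ val_inj); apply: eq_card => x.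
    apply/imsetP/idP => [[[z zc] /=]|].
      by rewrite inE /= => vz ->; rewrite in_set zc.
    by rewrite inE => /andP[xc vx]; exists (exist _ x xc); rewrite ?inE.
  rewrite -sum1dep_card.
  transitivity (\sum_(E : {E : {set G} | E \in edge_set G}) \sum_(b : bool)
      (if v \in val E then (col (E, b) == c : nat) else 0)).
    rewrite pair_bigA /= big_mkcond; apply: eq_bigr => -[E b] _ /=.
    by rewrite andbC; case: (v \in val E) => //=; case: (_ == _).
  transitivity (\sum_(E : {E : {set G} | E \in edge_set G} | v \in val E) mult c (val E)).
    rewrite [RHS]big_mkcond; apply: eq_bigr => E _; case: (v \in val E); last by rewrite big1.
    by rewrite /col /= count_bool_nth ?count_colors // size_colors ?(valP E).
  rewrite -(big_sub_cond (edge_set G) (fun E : {set G} => v \in E) (mult c)) /=.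
  have -> : \sum_(E in edge_set G | v \in E) mult c E
     = \sum_(E in [set [set v; u] | u in [set u | sedge v u]]) mult c E.
    apply: eq_bigl => E; apply/andP/imsetP => [[/edgeP[a [b [ab ->]]]]|[u]].
      rewrite !inE => /orP[]/eqP->; first by exists b; rewrite ?inE.
      by exists a; [rewrite inE sedge_sym|apply: setUC].
    rewrite inE => vu ->; rewrite !inE eqxx; split=> //.
    by apply/existsP; exists v; apply/existsP; exists u; rewrite vu eqxx.
  rewrite big_imset /= => [|a b]; last first.
    rewrite !inE => va vb /eqP; rewrite set2_eq eqxx /=.
    by case/orP=> [/eqP//|/andP[/eqP h /eqP e]]; rewrite e h.
  rewrite /wdeg big_mkcond; apply: eq_bigr => u _; rewrite inE multE.
  case vu: (sedge v u) => //; apply/esym/eqP; have := we v u.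
  by rewrite vu => /esym/eqP; rewrite sum_nat_eq0 => /forallP/(_ c).
move=> u v /existsP[[x /= xc] /= /eqP ex].
have := valP x.1; rewrite /= ex => /edgeP[a [b [_ _]]].
rewrite !degE; have [_] := wi c; apply.
rewrite -multE -ex -count_colors -has_count; apply/hasP; exists c; rewrite /= ?eqxx //.
move/eqP: xc => <-; rewrite /col mem_nth // size_colors ?(valP x.1) //.
by case: x.2.
Qed.

(** Strong induction finds the minimum; excluded middle decides whether fewer colours suffice. *)
Lemma exists_lir (M : multigraph) n : locally_irregular_colorable M n ->
  exists k, is_lir M k /\ k <= n.
Proof.
elim/ltn_ind: n => n IH Mn.
have [[j [jn Mj]]|no] := classic (exists j, j < n /\ locally_irregular_colorable M j).
  by have [k [Mk kj]] := IH j jn Mj; exists k; split=> //; apply: leq_trans kj (ltnW jn).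
exists n; split=> //; split=> // j Mj; rewrite leqNgt; apply/negP => jn.
by apply: no; exists j.
Qed.

(** The ends of an isolated edge are closed under adjacency, so by connectivity there are no other
    vertices and the graph is a single edge. *)
Lemma connected_no_isolated_edge (G : sgraph) : connected_graph G ->
  ~ isomorphic G (complete_graph 2) -> no_isolated_edge (@sedge G).
Proof.
move=> [_ conn] nK2 u v uv.
have [/existsP[x /orP h]|/existsPn none] :=
  boolP [exists x, sedge u x && (x != v) || sedge v x && (x != u)].
  by exists x.
case: nK2; have only x y : (x == u) || (x == v) -> sedge x y -> (y == u) || (y == v).
  have := none y; rewrite negb_or !negb_and !negbK => /andP[h1 h2].
  by case/orP=> /eqP-> xy; move: h1 h2; rewrite xy /= => ? ?; apply/orP; auto.
have all_uv x : (x == u) || (x == v).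
  case/connectP: (conn u x) => p pP ->.
  have : (u == u) || (u == v) by rewrite eqxx.
  suff last_uv (z : G) : path (@sedge G) z p -> (z == u) || (z == v) ->
      (last z p == u) || (last z p == v) by exact: last_uv.
  elim: p z {pP} => //= y p IH z /andP[zy yp] zuv.
  by apply: IH yp _; apply: only zuv zy.
have u_v : u != v by apply: contraTneq uv => ->; rewrite sedge_irrefl.
pose f x : complete_graph 2 := if x == u then ord0 else ord_max : 'I_2.
have fE x y : (f x == f y) = (x == y).
  rewrite /f; have := all_uv x; have := all_uv y.
  case: (eqVneq x u) => [->|xu]; case: (eqVneq y u) => [->|yu] //=.
    by rewrite (negbTE xu).
  by move=> /eqP -> /eqP ->; rewrite !eqxx.
exists f => [|x y].
  exists (fun i : 'I_2 => if i == ord0 then u else v) => [x|i]; rewrite /f.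
    by have := all_uv x; case: (eqVneq x u) => [->|xu] //= /eqP.
  case: (i =P ord0) => [->|ne]; first by rewrite eqxx.
  rewrite eq_sym (negbTE u_v); apply: val_inj.
  by case: i ne => [[|[|]]] //= ? []; apply: val_inj.
rewrite /= fE; have := all_uv x; have := all_uv y.
move=> /orP[]/eqP-> /orP[]/eqP->; rewrite ?eqxx ?sedge_irrefl //.
  by rewrite sedge_sym uv eq_sym u_v.
by rewrite uv u_v.
Qed.

Theorem theorem5 (G : sgraph) (Gconn : connected_graph G)
    (GnK2 : ~ isomorphic G (complete_graph 2)) :
  exists k : nat, is_lir (double_graph G) k /\ k <= 76.
Proof.
apply/exists_lir/colorable_of_decomp.
apply: (decomp_leq (n1 := 75)) => //; apply: decomp_double.
- exact: sedge_sym.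
- exact: sedge_irrefl.
exact: connected_no_isolated_edge.
Qed.
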